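(* Let $\omega=A_0\,dx_0+A_1\,dx_1+A_2\,dx_2\in\mathcal{F}^1(\mathbb{P}^2,e)$ and let $F=(F_0:F_1:F_2):\mathbb{P}^n\dashrightarrow\mathbb{P}^2$ be a dominant rational map given by homogeneous polynomials $F_i$ of the same degree $\nu$, such that $(F,\omega)$ is a generic pair. Then \[ I(F^*\omega)=K(F^*\omega)=\big(A_0(F),A_1(F),A_2(F)\big). \]
   Context: For $m\ge 2$, $S_m=\mathbb{C}[x_0,\ldots,x_m]$, $R=\sum x_i\partial/\partial x_i$, and $\mathcal{F}^1(\mathbb{P}^m,e)$ ($e\ge2$) is the set of (classes up to scalar of) $\omega=\sum B_i dx_i$, $B_i\in S_m$ homogeneous of degree $e-1$, not all zero, with $i_R\omega=0$, $\omega\wedge d\omega=0$ and zero locus $\mathrm{sing}(\omega)\subseteq\mathbb{P}^m$ of codimension $\ge2$. For such $\omega$: $\mathscr{C}(\eta)$ denotes the ideal of coefficients of a form $\eta$, $J(\omega)=\mathscr{C}(\omega)$, $I(\omega)=\{h: h\,d\omega=\omega\wedge\eta\text{ for some polynomial 1-form }\eta\}$, $K(\omega)=(J(\omega):\mathscr{C}(d\omega))$. The pullback $F^*\omega=\sum_i A_i(F)\,dF_i$ is an integrable 1-form on $\mathbb{C}^{n+1}$ descending to $\mathbb{P}^n$. $(F,\omega)$ is a generic pair if: $\mathrm{sing}(\omega)$ is reduced and consists only of Kupka points (points where $\omega=0$ and $d\omega\neq0$), the critical values of $F$ are disjoint from $\mathrm{sing}(\omega)$, and the set of critical points of $F$ is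 disjoint from $\{F_0=F_1=F_2=0\}$. *)

(* Defs.v *)
From HB Require Import structures.
From mathcomp Require Import all_boot all_order all_algebra.
From mathcomp Require Import Rstruct complex.
From mathcomp Require Import mpoly.
Set Implicit Arguments. Unset Strict Implicit. Unset Printing Implicit Defensive.
Import Order.TTheory GRing.Theory Num.Theory.
Local Open Scope ring_scope.

Definition Cf : fieldType := complex Rdefinitions.R.

(** S = C[x_0,...,x_{N-1}] ; for P^m we use N = m+1 variables. *)
Notation Pol N := {mpoly Cf[N]}.

(** Polynomial 1-forms sum_i w i dx_i and 2-forms sum_{i<j} t i j dx_i /\ dx_j
    (2-forms are stored as alternating functions of (i,j)). *)
Definition form1 N := 'I_N -> Pol N.
Definition form2 N := 'I_N -> 'I_N -> Pol N.

(** contraction with the radial field R = sum x_i d/dx_i *)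
Definition iR N (w : form1 N) : Pol N := \sum_(i < N) 'X_i * w i.

Definition dform N (w : form1 N) : form2 N :=
  fun i j => (w j)^`M(i) - (w i)^`M(j).

Definition wedge11 N (w e : form1 N) : form2 N :=
  fun i j => w i * e j - w j * e i.

Definition wedge12 N (w : form1 N) (t : form2 N) : 'I_N -> 'I_N -> 'I_N -> Pol N :=
  fun i j k => w i * t j k - w j * t i k + w k * t i j.

Definition integrable N (w : form1 N) : Prop :=
  forall i j k, wedge12 w (dform w) i j k = 0.

Definition in_ideal N (I : finType) (g : I -> Pol N) (h : Pol N) : Prop :=
  exists c : I -> Pol N, h = \sum_(i : I) c i * g i.

Definition coef_ideal1 N (w : form1 N) : Pol N -> Prop := in_ideal w.
Definition coef_ideal2 N (t : form2 N) : Pol N -> Prop :=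
  in_ideal (fun ij : 'I_N * 'I_N => t ij.1 ij.2).

Definition J_ideal N (w : form1 N) : Pol N -> Prop := coef_ideal1 w.

Definition I_ideal N (w : form1 N) (h : Pol N) : Prop :=
  exists eta : form1 N, forall i j, h * dform w i j = wedge11 w eta i j.

Definition K_ideal N (w : form1 N) (h : Pol N) : Prop :=
  forall c, coef_ideal2 (dform w) c -> J_ideal w (h * c).

Definition nonzero_pt N (x : 'I_N -> Cf) : Prop := exists i, x i != 0.

(** x (nonzero) represents a point of sing(w) in P^{N-1} *)
Definition in_sing N (w : form1 N) (x : 'I_N -> Cf) : Prop :=
  nonzero_pt x /\ forall i, (w i).@[x] = 0.

(** sing(w) has codimension >= 2 in P^2, i.e. it is a finite set of points *)
Definition sing_codim2_P2 (w : form1 3) : Prop :=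
  exists (k : nat) (p : 'I_k -> 'I_3 -> Cf),
    forall x, in_sing w x -> exists (j : 'I_k) (c : Cf), forall i, x i = c * p j i.

Definition foliation_P2 (e : nat) (w : form1 3) : Prop :=
  [/\ (2 <= e)%N,
      (forall i, w i \is (e.-1).-homog),
      (exists i, w i != 0),
      iR w = 0 &
      integrable w /\ sing_codim2_P2 w].

(** scheme-theoretic reducedness of sing(w): the saturation of J(w) with
    respect to the irrelevant ideal is a radical ideal *)
Definition J_sat N (w : form1 N) (h : Pol N) : Prop :=
  exists k : nat, forall i : 'I_N, J_ideal w ('X_i ^+ k * h).
Definition sing_reduced N (w : form1 N) : Prop :=
  forall (h : Pol N) (k : nat), J_sat w (h ^+ k) -> J_sat w h.

Definition all_kupka N (w : form1 N) : Prop :=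
  forall x, in_sing w x -> exists i j, (dform w i j).@[x] != 0.

Definition Fpt n (F : 'I_3 -> Pol n.+1) (x : 'I_n.+1 -> Cf) : 'I_3 -> Cf :=
  fun i => (F i).@[x].

(** Jacobian matrix of the affine cone map C^{n+1} -> C^3 at x *)
Definition jacobian n (F : 'I_3 -> Pol n.+1) (x : 'I_n.+1 -> Cf) : 'M[Cf]_(3, n.+1) :=
  \matrix_(i < 3, j < n.+1) ((F i)^`M(j)).@[x].

Definition critical_pt n (F : 'I_3 -> Pol n.+1) (x : 'I_n.+1 -> Cf) : Prop :=
  nonzero_pt x /\ (\rank (jacobian F x) < 3)%N.

(** dominance: the image of F (outside the base locus) is Zariski dense in P^2,
    i.e. it is contained in no curve G = 0 (G nonzero homogeneous) *)
Definition dominant n (F : 'I_3 -> Pol n.+1) : Prop :=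
  forall (G : Pol 3) (d : nat), G != 0 -> G \is d.-homog ->
    exists x, nonzero_pt x /\ nonzero_pt (Fpt F x) /\ G.@[Fpt F x] != 0.

Definition generic_pair n (F : 'I_3 -> Pol n.+1) (w : form1 3) : Prop :=
  [/\ sing_reduced w, all_kupka w,
      (forall x, critical_pt F x -> nonzero_pt (Fpt F x) -> ~ in_sing w (Fpt F x)) &
      (forall x, critical_pt F x -> nonzero_pt (Fpt F x))].

Definition compF n (F : 'I_3 -> Pol n.+1) (p : Pol 3) : Pol n.+1 :=
  p \mPo [tuple F i | i < 3].

Definition pullback n (F : 'I_3 -> Pol n.+1) (w : form1 3) : form1 n.+1 :=
  fun j => \sum_(i < 3) compF F (w i) * (F i)^`M(j).

(* Main.v *)
(** Write a = A(F) and b = (curl A)(F).  By Euler's identity e a = b x F, so (a)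
    is the ideal of 2-minors of the matrix with rows b and F.  The inclusions
    (a) <= I <= K are formal: contracting w /\ dw = 0 gives A_l dA = A /\ eta_l,
    and this pulls back.

    For K <= (a): Cramer's rule gives h b_m M in (a) for h in K and every
    3-minor M of the Jacobian of F.  The ideal of those s with s h in (a) contains
    a and all the b_m M, so by genericity its zeros lie on F = 0, and by the
    Nullstellensatz it contains powers of the F_k.  It remains to see that (a) is
    saturated with respect to (F), which is a Hilbert-Burch argument resting on
    the exactness of the Koszul complex of F and on a x t = 0 => t in S a.

    Exactness holds after multiplication by a power of each M, because there are
    derivations E_k with E_k F_l = M delta_kl, and a derivation with D f = M, D I
    in I makes f a nonzerodivisor mod I up to powers of M ([deriv_regular]).  As
    the M and the F (or the a) have no common zero but 0, the failure of exactness
    is killed by powers of the coordinates, hence vanishes by depth: a polynomial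
    ring in at least three variables has depth at least three.  The exactness for
    a also uses that the singular set of A is a finite union of lines through 0. *)

Require Import Defs.
From Stdlib Require Import Rbase Lra Classical ClassicalEpsilon.
From HB Require Import structures.
From mathcomp Require Import all_boot all_order all_algebra.
From mathcomp Require Import Rstruct complex.
From mathcomp Require Import mpoly.
From mathcomp Require Import ring zify.
Set Implicit Arguments. Unset Strict Implicit. Unset Printing Implicit Defensive.
Import Order.TTheory GRing.Theory Num.Theory.
Local Open Scope ring_scope.

(** * Ideals and the ascending chain condition *)

Record is_ideal (R : comNzRingType) (P : R -> Prop) : Prop := IsIdeal {
  ideal0 : P 0;
  idealD : forall x y, P x -> P y -> P (x + y);
  idealM : forall c x, P x -> P (c * x) }.

Section IdealTheory.
Variables (R : comNzRingType) (P : R -> Prop).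
Hypothesis idP : is_ideal P.

Lemma ideal_mulr c x : P x -> P (x * c).
Proof. by rewrite mulrC; apply: idealM. Qed.

Lemma idealN x : P x -> P (- x).
Proof. by rewrite -mulN1r; apply: idealM. Qed.

Lemma idealB x y : P x -> P y -> P (x - y).
Proof. by move=> Px Py; apply: idealD => //; apply: idealN. Qed.

Lemma ideal_sum (I : Type) (r : seq I) (Q : pred I) (f : I -> R) :
  (forall i, Q i -> P (f i)) -> P (\sum_(i <- r | Q i) f i).
Proof.
move=> Pf; elim/big_rec: _ => [|i x Qi Px]; first exact: ideal0.
by apply: idealD => //; apply: Pf.
Qed.

Lemma ideal_pow_le m k c : (m <= k)%N -> P (c ^+ m) -> P (c ^+ k).
Proof. by move=> /subnK <- Pc; rewrite exprD; apply: idealM. Qed.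

Lemma ideal_scaled c : is_ideal (fun s => P (s * c)).
Proof.
split=> [|x y Px Py|d x Px]; first by rewrite mul0r; apply: ideal0.
  by rewrite mulrDl; apply: idealD.
by rewrite -mulrA; apply: idealM.
Qed.

Lemma ideal_powD (c x y : R) k l :
  P (c ^+ k * x) -> P (c ^+ l * y) -> P (c ^+ (k + l) * (x + y)).
Proof.
move=> Px Py.
have -> : c ^+ (k + l) * (x + y) = c ^+ l * (c ^+ k * x) + c ^+ k * (c ^+ l * y).
  by rewrite exprD; ring.
by apply: idealD => //; apply: idealM.
Qed.

Lemma comb3_ideal (h x y z f g k : R) :
  P (h * f) -> P (h * g) -> P (h * k) ->
  P ((x * f + y * g + z * k) * h).
Proof.
move=> Pf Pg Pk.
have -> : (x * f + y * g + z * k) * h = x * (h * f) + y * (h * g) + z * (h * k).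
  by ring.
by do !(apply: idealD => //); apply: idealM.
Qed.

End IdealTheory.

(** Induction on the sum of the exponents [N l], for all multipliers [s] at once: passing from [s]
    to [s * z l] lowers the exponent at [l], and saturation leads back to [s]. *)
Lemma sat_pow (R : comNzRingType) (P : R -> Prop) (I : finType) (z : I -> R) :
  is_ideal P ->
  (forall s, (forall l, P (s * z l)) -> P s) ->
  (forall l, exists k, P (z l ^+ k)) -> P 1.
Proof.
move=> idP sat pw.
have pw' l : {k | P (z l ^+ k)} by apply: constructive_indefinite_description.
pose N l := sval (pw' l).
suff gen (k : nat) : forall (N : I -> nat) s, (\sum_l N l <= k)%N ->
    (forall l, P (s * z l ^+ N l)) -> P s.
  by apply: (gen _ N 1 (leqnn _)) => l; rewrite mul1r; exact: (svalP (pw' l)).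
elim: k => [|k IH] {}N s leN Ps.
  apply: sat => l; have := Ps l.
  have /eqP -> : N l == 0%N.
    by have := leN; rewrite leqn0 sum_nat_eq0 => /forallP/(_ l).
  by rewrite mulr1; apply: ideal_mulr.
case: (classic (exists l, N l = 0%N)) => [[l Nl]|nN].
  by have := Ps l; rewrite Nl mulr1.
apply: sat => l.
have Nl : (0 < N l)%N by rewrite lt0n; apply/eqP => Nl; apply: nN; exists l.
apply: (IH (fun j => if j == l then (N l).-1 else N j)).
  move: leN; rewrite (bigD1 l) //= [X in _ -> (X <= _)%N](bigD1 l) //= eqxx.
  rewrite [X in _ -> (_ + X <= _)%N](eq_bigr N) => [|i /negPf -> //].
  by lia.
move=> j; case: eqP => [->|_].
  by rewrite -mulrA -exprS prednK //; exact: Ps.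
by rewrite mulrAC; apply: ideal_mulr => //; exact: Ps.
Qed.

(** Beyond any index there is one where [f] attains its minimum over the tail starting there;
    iterating this choice gives [phi]. *)
Lemma nondecreasing_subseq (f : nat -> nat) :
  exists phi : nat -> nat, (forall i j, (i < j)%N -> (phi i < phi j)%N) /\
    (forall i j, (i <= j)%N -> (f (phi i) <= f (phi j))%N).
Proof.
have tailmin k : exists i, (k <= i)%N /\ forall j, (i <= j)%N -> (f i <= f j)%N.
  have gen v : forall k, (f k <= v)%N ->
      exists i, (k <= i)%N /\ forall j, (i <= j)%N -> (f i <= f j)%N.
    elim: v => [|v IH] {}k fk.
      exists k; split=> // j _.
      by apply: (leq_trans fk).
    case: (classic (exists j, (k <= j)%N /\ (f j <= v)%N)) => [[j [kj fj]]|no].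
      have [i [ji imin]] := IH j fj.
      by exists i; split=> //; apply: leq_trans ji.
    exists k; split=> // j kj; apply: (leq_trans fk).
    by rewrite ltnNge; apply/negP => fj; apply: no; exists j.
  exact: (gen (f k) k (leqnn _)).
pose g k := sval (constructive_indefinite_description _ (tailmin k)).
have gP k : (k <= g k)%N /\ forall j, (g k <= j)%N -> (f (g k) <= f j)%N.
  exact: (svalP (constructive_indefinite_description _ (tailmin k))).
pose phi := fix phi k := if k is k'.+1 then g (phi k').+1 else g 0%N.
have phi_lt i j : (i < j)%N -> (phi i < phi j)%N.
  elim: j => // j IH; rewrite ltnS leq_eqVlt => /predU1P[->|/IH] /=.
    by have [] := gP (phi j).+1.
  by move/leq_trans; apply; apply: ltnW; have [] := gP (phi j).+1.
exists phi; split=> // i j; rewrite leq_eqVlt => /predU1P[-> //|/phi_lt ij].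
have [k phik] : exists k, phi i = g k by case: i {ij} => [|i]; eexists.
by move: ij; rewrite phik => /ltnW; have [_] := gP k; apply.
Qed.

(** Coordinates are made nondecreasing one at a time by passing to subsequences; [r] counts those
    already treated. *)
Lemma dickson n (m : nat -> 'X_{1..n}) :
  exists i j, (i < j)%N /\ (m i <= m j)%MM.
Proof.
suff gen r : exists phi : nat -> nat,
    (forall i j, (i < j)%N -> (phi i < phi j)%N) /\
    forall l : 'I_n, (l < r)%N ->
      forall i j, (i <= j)%N -> (m (phi i) l <= m (phi j) l)%N.
  have [phi [inc mon]] := gen n.
  exists (phi 0%N), (phi 1%N); split; first exact: inc.
  by apply/mnm_lepP => l; apply: mon.
elim: r => [|r [phi [inc mon]]]; first by exists id.
case: (ltnP r n) => [ltrn|lenr]; last first.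
  by exists phi; split=> // l _; apply: mon; apply: leq_trans lenr.
have [psi [incp monp]] := nondecreasing_subseq (fun k => m (phi k) (Ordinal ltrn)).
exists (phi \o psi); split=> [i j /incp/inc //|l].
rewrite ltnS leq_eqVlt => /predU1P[lr|lr] i j ij.
  have -> : l = Ordinal ltrn by apply: val_inj.
  exact: monp.
apply: mon => //; move: ij; rewrite leq_eqVlt => /predU1P[-> //|/incp].
exact: ltnW.
Qed.

Lemma mpoly_alg_ind (R : comNzRingType) n (P : {mpoly R[n]} -> Prop) :
  (forall c, P c%:MP) -> (forall i, P 'X_i) ->
  (forall p q, P p -> P q -> P (p + q)) ->
  (forall p q, P p -> P q -> P (p * q)) -> forall p, P p.
Proof.
move=> PC PX PD PM p; rewrite [p]mpolyE; apply: (big_ind P) => // [|m _].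
  by rewrite -mpolyC0.
rewrite -mul_mpolyC; apply: (PM) => //; rewrite mpolyXE_id.
apply: (big_ind P) => // [|i _]; first by rewrite -mpolyC1.
elim: (m i) => [|k IH]; first by rewrite expr0 -mpolyC1.
by rewrite exprS; apply: PM.
Qed.

Section Noetherian.
Variables (K : fieldType) (n : nat).
Notation S := {mpoly K[n]}.

(** One division step, with the quotient of the leading terms as [c]. *)
Lemma mlead_cancel (f g : S) : f != 0 -> g != 0 -> (mlead f <= mlead g)%MM ->
  exists c, (g - c * f == 0) || (mlead (g - c * f) < mlead g)%O.
Proof.
move=> f0 g0 le_fg.
pose q : S := (mleadc g / mleadc f) *: 'X_[mlead g - mlead f].
have cf0 : mleadc f != 0 by rewrite mleadc_eq0.
have cg0 : mleadc g != 0 by rewrite mleadc_eq0.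
have q0 : q != 0.
  rewrite scaler_eq0 negb_or mulf_neq0 ?invr_eq0 //=.
  by rewrite -mleadc_eq0 mleadXm mcoeffX eqxx oner_neq0.
have lq : mlead q = (mlead g - mlead f)%MM.
  by rewrite mleadZ ?mleadXm // mulf_neq0 ?invr_eq0.
have lqf : mlead (q * f) = mlead g by rewrite mleadM // lq submK.
have lc : (q * f)@_(mlead g) = mleadc g.
  rewrite -{1}lqf mleadM // mleadcM lq /q mcoeffZ mcoeffX eqxx mulr1.
  by rewrite divfK.
exists q; case: eqP => //= /eqP nz.
have le : (mlead (g - q * f) <= mlead g)%O.
  by apply: le_trans (mleadB_le _ _) _; rewrite lqf joinxx.
rewrite lt_neqAle le andbT; apply/eqP => eql.
by move: nz; rewrite -mleadc_eq0 eql mcoeffB lc subrr eqxx.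
Qed.

(* Choose f_k in I_(k+1) but not in I_k with minimal leading monomial; a
   divisibility between two of these monomials contradicts minimality. *)
Theorem mpoly_acc (I : nat -> S -> Prop) :
  (forall k, is_ideal (I k)) -> (forall k f, I k f -> I k.+1 f) ->
  exists k, forall f, I k.+1 f -> I k f.
Proof.
move=> idI incI; apply: NNPP => no.
have inc i j f : (i <= j)%N -> I i f -> I j f.
  elim: j => [|j IH]; first by rewrite leqn0 => /eqP ->.
  by rewrite leq_eqVlt => /predU1P[-> //|/IH h /h]; apply: incI.
have minP k : exists f, (I k.+1 f /\ ~ I k f) /\
    forall g, I k.+1 g -> ~ I k g -> (mlead f <= mlead g)%O.
  apply: NNPP => nomin.
  have all_in m : forall f, mlead f = m -> I k.+1 f -> I k f.
    elim/(@ltmwf n): m => m IH f lf If; apply: NNPP => nIf; apply: nomin.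
    exists f; split=> // g Ig nIg; rewrite leNgt; apply/negP; rewrite lf => lt.
    exact: nIg (IH _ lt g erefl Ig).
  by apply: no; exists k => f; apply: all_in erefl.
pose h k := sval (constructive_indefinite_description _ (minP k)).
have hP k : (I k.+1 (h k) /\ ~ I k (h k)) /\
    forall g, I k.+1 g -> ~ I k g -> (mlead (h k) <= mlead g)%O.
  exact: (svalP (constructive_indefinite_description _ (minP k))).
have h0 k : h k != 0.
  by apply/eqP => hk; have [[_]] := hP k; rewrite hk; case; apply: ideal0.
have [i [j [ltij lej]]] := dickson (fun k => mlead (h k)).
have [c] := mlead_cancel (h0 i) (h0 j) lej.
have [[Ij nIj] minj] := hP j; have [[Ii _] _] := hP i.
have Ich : I j (c * h i) by apply: idealM => //; apply: inc Ii.
case/orP => [|lt].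
  by rewrite subr_eq0 => /eqP e; apply: nIj; rewrite e.
have nI : ~ I j (h j - c * h i).
  by move=> Id; apply: nIj; rewrite -(subrK (c * h i) (h j)); apply: idealD.
have Id : I j.+1 (h j - c * h i) by apply: idealB => //; apply: incI.
by have := minj _ Id nI; rewrite leNgt lt.
Qed.

(** Otherwise every ideal with [Q] lies strictly inside another one, and iterating a choice of the
    larger ideal violates the chain condition. *)
Lemma mpoly_maximal_ideal (Q : (S -> Prop) -> Prop) (J : S -> Prop) :
  Q J -> (forall P, Q P -> is_ideal P) ->
  exists P, Q P /\ forall P', Q P' -> (forall f, P f -> P' f) -> forall f, P' f -> P f.
Proof.
move=> QJ Qid; apply: NNPP => no.
have step (P : {P | Q P}) : exists P' : {P | Q P},
    (forall f, sval P f -> sval P' f) /\ ~ (forall f, sval P' f -> sval P f).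
  case: P => P QP; apply: NNPP => nP; apply: no; exists P; split=> // P' QP' sub f P'f.
  apply: NNPP => nPf; apply: nP; exists (exist _ P' QP'); split=> //= all.
  exact: nPf (all f P'f).
pose next P := sval (constructive_indefinite_description _ (step P)).
have nextP P : (forall f, sval P f -> sval (next P) f) /\
    ~ (forall f, sval (next P) f -> sval P f).
  exact: (svalP (constructive_indefinite_description _ (step P))).
pose I k := iter k next (exist _ J QJ).
have [k Ik] : exists k, forall f, sval (I k.+1) f -> sval (I k) f.
  apply: (mpoly_acc (I := fun k => sval (I k))) => [k|k f].
    by apply: Qid; exact: (svalP (I k)).
  by have [h _] := nextP (I k); exact: h.
by have [_] := nextP (I k); apply.
Qed.

End Noetherian.

(** * The Nullstellensatz *)

(** Uncountability as the pigeonhole principle that the Nullstellensatz consumes: a colouring by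
    natural numbers has an infinite fibre. *)
Definition uncountably_many (T : eqType) : Prop :=
  forall f : T -> nat, exists k, forall s : seq T, exists x, x \notin s /\ f x = k.

Section RealLine.
Local Open Scope R_scope.

Lemma shrink_interval (a b : R) (s : seq R) : a < b ->
  exists a' b', [/\ a <= a', a' < b', b' <= b &
    forall x, a' <= x <= b' -> x \notin s].
Proof.
elim: s a b => [|c s IH] a b ab; first by exists a, b; split=> //; apply: Rle_refl.
have [a1 [b1 [aa1 ab1 bb1 nc]]] : exists a' b', [/\ a <= a', a' < b', b' <= b &
    ~ (a' <= c <= b')].
  case: (Rle_dec c ((a + b) / 2)) => hc.
    by exists ((a + 3 * b) / 4), b; split; lra.
  by exists a, ((a + b) / 2); split; lra.
have [a2 [b2 [aa2 ab2 bb2 ns]]] := IH a1 b1 ab1.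
exists a2, b2; split; [lra|lra|lra|move=> x hx].
rewrite inE negb_or ns // andbT; apply/eqP => xc; apply: nc; rewrite -xc; lra.
Qed.

(** Cantor's nested intervals: if all fibres were finite, closed intervals could be nested so that
    the one numbered [k.+1] avoids fibre [k], and a common point would have no colour. *)
Lemma uncountably_many_R : uncountably_many R.
Proof.
move=> f; apply: NNPP => no.
have cover k : exists s : seq R, forall x, f x = k -> x \in s.
  apply: NNPP => nk; apply: no; exists k => s; apply: NNPP => ns.
  apply: nk; exists s => x fx; case: (boolP (x \in s)) => // xs.
  by case: ns; exists x.
pose s k := sval (constructive_indefinite_description _ (cover k)).
have sP k x : f x = k -> x \in s k.
  exact: (svalP (constructive_indefinite_description _ (cover k)) x).
have step k (p : {p : R * R | p.1 < p.2}) : exists q : {p : R * R | p.1 < p.2},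
    [/\ (sval p).1 <= (sval q).1, (sval q).2 <= (sval p).2 &
    forall x, (sval q).1 <= x <= (sval q).2 -> x \notin s k].
  have [a [b [h1 h2 h3 h4]]] := shrink_interval (s k) (svalP p).
  by exists (exist (fun p : R * R => p.1 < p.2) (a, b) h2).
pose next k p := sval (constructive_indefinite_description _ (step k p)).
have nextP k p : [/\ (sval p).1 <= (sval (next k p)).1,
    (sval (next k p)).2 <= (sval p).2 &
    forall x, (sval (next k p)).1 <= x <= (sval (next k p)).2 -> x \notin s k].
  exact: (svalP (constructive_indefinite_description _ (step k p))).
have lt01 : 0 < 1 by lra.
pose I := fix I k := if k is k'.+1 then next k' (I k')
                     else exist (fun p : R * R => p.1 < p.2) (0, 1) lt01.
pose a k := (sval (I k)).1; pose b k := (sval (I k)).2.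
have inca (i j : nat) : (i <= j)%N -> a i <= a j.
  elim: j => [|j IH]; first by rewrite leqn0 => /eqP ->; apply: Rle_refl.
  rewrite leq_eqVlt => /predU1P[-> |/IH h]; first exact: Rle_refl.
  by apply: Rle_trans h _; have [] := nextP j (I j).
have decb (i j : nat) : (i <= j)%N -> b j <= b i.
  elim: j => [|j IH]; first by rewrite leqn0 => /eqP ->; apply: Rle_refl.
  rewrite leq_eqVlt => /predU1P[-> |/IH h]; first exact: Rle_refl.
  by apply: Rle_trans h; have [] := nextP j (I j).
have ltab k : a k < b k by exact: (svalP (I k)).
have leab (i j : nat) : a i <= b j.
  have h1 := inca _ _ (leq_maxl i j); have h2 := decb _ _ (leq_maxr i j).
  by have h3 := ltab (maxn i j); lra.
pose E x := exists k, x = a k.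
have bdE : bound E by exists (b 0%N) => x [k ->].
have exE : exists x, E x by exists (a 0%N), 0%N.
have [l [ubl lubl]] := completeness E bdE exE.
have al k : a k <= l by apply: ubl; exists k.
have lb k : l <= b k by apply: lubl => x [j ->].
have [_ _ h] := nextP (f l) (I (f l)).
by have := h l (conj (al (f l).+1) (lb (f l).+1)); rewrite sP.
Qed.

End RealLine.

Lemma uncountably_many_Cf : uncountably_many Cf.
Proof.
move=> f; have [k kP] := uncountably_many_R (fun x => f (x%:C)%C).
exists k => s; have [x [xs fx]] := kP [seq complex.Re z | z <- s].
exists (x%:C)%C; split=> //; apply: contra xs => xs.
by apply/mapP; exists (x%:C)%C.
Qed.

Lemma Cf_root (p : {poly Cf}) : size p != 1%N -> exists x, root p x.
Proof. exact: (@closed_rootP (complex Rdefinitions.R : closedFieldType) p). Qed.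

Lemma Cf_char0 k : k.+1%:R != 0 :> Cf.
Proof. by rewrite (@pnatr_eq0 (complex Rdefinitions.R)). Qed.

Section Nullstellensatz.
Variables (K : fieldType) (n : nat).
Hypothesis K_root : forall p : {poly K}, size p != 1%N -> exists x, root p x.
Hypothesis K_unc : uncountably_many K.
Notation S := {mpoly K[n]}.

Lemma fibre_uniq_seq (T : eqType) (f : T -> nat) k d :
  (forall s : seq T, exists x, x \notin s /\ f x = k) ->
  exists s : seq T, [/\ uniq s, size s = d & forall x, x \in s -> f x = k].
Proof.
move=> fk; elim: d => [|d [s [us ss fs]]]; first by exists [::].
have [x [xs fx]] := fk s; exists (x :: s); split=> /=; rewrite ?xs ?ss //.
by move=> y; rewrite inE => /predU1P[-> //|/fs].
Qed.

(** [N] counts the monomials of degree less than [d], so the coefficient matrix has more rows than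
    columns. *)
Lemma bounded_msize_dependent (d : nat) (N := #|{: 'X_{1..n < d}}|)
    (u : 'I_N.+1 -> S) : (forall a, msize (u a) <= d)%N ->
  exists v : 'I_N.+1 -> K, (exists a, v a != 0) /\ \sum_a v a *: u a = 0.
Proof.
move=> us; pose A := \matrix_(a < N.+1, b < N) (u a)@_(enum_val b : 'X_{1..n < d}).
have /rowV0Pn[v /sub_kermxP vA v0] : kermx A != 0.
  rewrite -mxrank_eq0 mxrank_ker subn_eq0 -ltnNge ltnS.
  exact: rank_leq_col.
exists (fun a => v 0 a); split.
  apply: NNPP => no; case/eqP: v0; apply/rowP => a; rewrite mxE.
  by apply/eqP/negPn/negP => va; apply: no; exists a.
apply/mpolyP => m; rewrite mcoeff0 raddf_sum /=.
case: (ltnP (mdeg m) d) => md; last first.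
  rewrite big1 // => a _; rewrite mcoeffZ memN_msupp_eq0 ?mulr0 //.
  by apply: msize_mdeg_ge; apply: leq_trans md.
have := congr1 (fun B : 'rV_N => B 0 (enum_rank (BMultinom md))) vA.
rewrite !mxE => vA0; rewrite -[RHS]vA0; apply: eq_bigr => a _.
by rewrite mcoeffZ !mxE enum_rankK.
Qed.

(* An ideal I maximal among those containing P and no power of f is prime.  If
   no X_i - c lay in I, then (X_i - c) u_c = f^k modulo I for all c; as K is
   uncountable, infinitely many of the u_c live in one finite-dimensional space
   with one exponent k, and a linear relation between them puts a nonzero
   univariate polynomial in X_i into I. *)
Theorem nullstellensatz (P : S -> Prop) (f : S) : is_ideal P ->
  (forall x : 'I_n -> K, (forall g, P g -> g.@[x] = 0) -> f.@[x] = 0) ->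
  exists k, P (f ^+ k).
Proof.
move=> idP fV; apply: NNPP => noP.
pose Q (I : S -> Prop) :=
  [/\ is_ideal I, forall g, P g -> I g & forall k, ~ I (f ^+ k)].
have QP : Q P by split=> // k Pk; apply: noP; exists k.
have Qid I : Q I -> is_ideal I by case.
have [I [[idI PI nI] maxI]] := mpoly_maximal_ideal QP Qid.
(* By maximality, the ideal generated by [I] and a [g] outside it contains a power of [f]. *)
have inv g : ~ I g -> exists k u, I (u * g - f ^+ k).
  move=> nIg; apply: NNPP => no; apply: nIg.
  pose I' h := exists u, I (h - u * g).
  have idI' : is_ideal I'.
    split=> [|x y [u Iu] [v Iv]|c x [u Iu]].
    - by exists 0; rewrite mul0r subr0; apply: ideal0.
    - by exists (u + v); rewrite mulrDl opprD addrACA; apply: idealD.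
    - by exists (c * u); rewrite -mulrA -mulrBr; apply: idealM.
  apply: (maxI I' _ _ g) => [|h Ih|]; last 1 first.
  - by exists 1; rewrite mul1r subrr; apply: ideal0.
  - split=> // [h Ph|k [u Iu]].
      by exists 0; rewrite mul0r subr0; apply: PI.
    by apply: no; exists k, u; rewrite -opprB; apply: idealN.
  - by exists 0; rewrite mul0r subr0.
have primeI g h : I (g * h) -> I g \/ I h.
  move=> Igh; apply: NNPP => /not_or_and[/inv[k [u Iu]] /inv[l [v Iv]]].
  apply: (nI (k + l)%N); rewrite exprD.
  have -> : f ^+ k * f ^+ l = u * v * (g * h) - (u * g - f ^+ k) * (v * h)
      - f ^+ k * (v * h - f ^+ l) by ring.
  by apply: idealB => //; [apply: idealB => //|]; rewrite ?[_ * (v * h)]mulrC;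
    apply: idealM.
have n1 : ~ I 1 by exact: nI 0%N.
have nC c : c != 0 -> ~ I c%:MP.
  move=> c0 Ic; apply: n1; have -> : 1 = (c^-1)%:MP * c%:MP :> S.
    by rewrite -mpolyCM mulVf.
  exact: idealM.
have factorI i (q : {poly K}) : q != 0 ->
    I (map_poly (@mpolyC n K) q).['X_i] -> exists c, I ('X_i - c%:MP).
  elim: {q}(size q) {-2}q (leqnn (size q)) => [|d IH] q.
    by rewrite leqn0 size_poly_eq0 => /eqP ->; rewrite eqxx.
  move=> sq q0 Iq; case: (eqVneq (size q) 1%N) => [/eqP/size_poly1P[c c0 qc]|].
    by move: Iq; rewrite qc map_polyC hornerC => /(nC _ c0).
  move=> /K_root[r /factor_theorem[q' qE]].
  move: Iq; rewrite qE rmorphM /= hornerM map_polyXsubC hornerXsubC.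
  have q'0 : q' != 0 by apply: contraNneq q0 => q'0; rewrite qE q'0 mul0r.
  case/primeI => [Iq'|Ir]; last by exists r.
  apply: (IH q') => //.
  by move: sq; rewrite qE size_mul ?polyXsubC_eq0 // size_XsubC addnS addn1.
have pt i : exists c, I ('X_i - c%:MP).
  apply: NNPP => no.
  have ex c : exists ku : nat * S, I (ku.2 * ('X_i - c%:MP) - f ^+ ku.1).
    case: (inv ('X_i - c%:MP)) => [Ic|k [u Iu]]; first by apply: no; exists c.
    by exists (k, u).
  pose ku c := sval (constructive_indefinite_description _ (ex c)).
  have kuP c : I ((ku c).2 * ('X_i - c%:MP) - f ^+ (ku c).1).
    exact: (svalP (constructive_indefinite_description _ (ex c))).
  have [z zP] := K_unc (fun c => pickle ((ku c).1, msize (ku c).2)).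
  have [c0 [_ c0P]] := zP [::].
  pose k := (ku c0).1; pose d := msize (ku c0).2.
  pose N := #|{: 'X_{1..n < d}}|.
  have [s [us ss sP]] := fibre_uniq_seq N.+1 zP.
  pose t a := nth c0 s a.
  have tP (a : 'I_N.+1) : (ku (t a)).1 = k /\ msize (ku (t a)).2 = d.
    have /sP : t a \in s by rewrite mem_nth // ss.
    by rewrite -c0P => /(pcan_inj pickleK) [].
  have tinj (a b : 'I_N.+1) : a != b -> t a - t b != 0.
    by rewrite subr_eq0 nth_uniq ?ss.
  have [a|v [[a va] vu]] := @bounded_msize_dependent d (fun a => (ku (t a)).2).
    by have [_ ->] := tP a.
  (* Modulo [I] each [u] behaves like f^k / (X_i - t_a), so [q] is the numerator of the sum of v_a /
     (X - t_a). At [t a] only the term of index [a] survives, hence [q] is nonzero. *)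
  pose q : {poly K} := \sum_a v a *: \prod_(b | b != a) ('X - (t b)%:P).
  have q0 : q != 0.
    have : q.[t a] != 0.
      rewrite horner_sum (bigD1 a) //= [X in _ + X]big1 ?addr0 => [|c ca].
        rewrite hornerZ mulf_neq0 // horner_prod; apply/prodf_neq0 => b ba.
        by rewrite hornerXsubC tinj // eq_sym.
      rewrite hornerZ horner_prod (bigD1 a) 1?eq_sym //=.
      by rewrite hornerXsubC subrr mul0r mulr0.
    by apply: contraNneq => ->; rewrite horner0.
  have qX : (map_poly (@mpolyC n K) q).['X_i] =
      \sum_a v a *: \prod_(b | b != a) ('X_i - (t b)%:MP).
    rewrite rmorph_sum /= horner_sum; apply: eq_bigr => c _.
    rewrite map_polyZ hornerZ /= mul_mpolyC; congr (_ *: _).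
    rewrite rmorph_prod /= horner_prod; apply: eq_bigr => b _.
    by rewrite map_polyXsubC hornerXsubC.
  have alg (r y w p h : S) : r * (y * p) = - y * (p * (w * h - r)) + y * w * (h * p).
    by ring.
  have : I (f ^+ k * (map_poly (@mpolyC n K) q).['X_i]).
    have -> : f ^+ k * (map_poly (@mpolyC n K) q).['X_i] =
        \sum_b (- v b)%:MP * (\prod_(c | c != b) ('X_i - (t c)%:MP) *
          ((ku (t b)).2 * ('X_i - (t b)%:MP) - f ^+ (ku (t b)).1)).
      have vu0 : \sum_b (v b *: (ku (t b)).2) * \prod_(c < N.+1) ('X_i - (t c)%:MP) = 0.
        by rewrite -mulr_suml vu mul0r.
      rewrite qX mulr_sumr -[RHS]addr0 -[X in _ = _ + X]vu0 -big_split /=.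
      apply: eq_bigr => b _; have [-> _] := tP b.
      rewrite [\prod_(c < N.+1) ('X_i - (t c)%:MP)](bigD1 b) //= -!mul_mpolyC mpolyCN.
      exact: alg.
    by apply: ideal_sum => // b _; apply: idealM => //; apply: idealM.
  case/primeI => [/nI //|/(factorI i _ q0)].
  exact: no.
(* Modulo [I] every polynomial is congruent to its value at [x]. Hence [x] is a zero of [P], [f]
   vanishes there, and [f] falls into [I]. *)
pose x i := sval (constructive_indefinite_description _ (pt i)).
have xP i : I ('X_i - (x i)%:MP).
  exact: (svalP (constructive_indefinite_description _ (pt i))).
have ev g : I (g - g.@[x]%:MP).
  elim/mpoly_alg_ind: g => [c|i|g1 g2 h1 h2|g1 g2 h1 h2].
  - by rewrite mevalC subrr; apply: ideal0.
  - by rewrite mevalXU.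
  - by rewrite mevalD mpolyCD opprD addrACA; apply: idealD.
  - rewrite mevalM mpolyCM.
    have -> : g1 * g2 - g1.@[x]%:MP * g2.@[x]%:MP =
      g2 * (g1 - g1.@[x]%:MP) + g1.@[x]%:MP * (g2 - g2.@[x]%:MP) by ring.
    by apply: idealD => //; apply: idealM.
have f0 : f.@[x] = 0.
  apply: fV => g /PI Ig; apply/eqP/negPn/negP => /nC; apply.
  by rewrite -(subKr g g.@[x]%:MP); apply: idealB.
by apply: (nI 1%N); rewrite expr1 -[f]subr0 -(mpolyC0 n K) -f0.
Qed.

End Nullstellensatz.

Definition nullstellensatz_Cf n := @nullstellensatz Cf n Cf_root uncountably_many_Cf.

(** * Derivations and Koszul complexes *)

Record is_derivation (R : comNzRingType) (D : R -> R) : Prop := IsDerivation {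
  derivationD : forall x y, D (x + y) = D x + D y;
  derivationM : forall x y, D (x * y) = D x * y + x * D y }.

Section Derivations.
Variables (R : comNzRingType) (D : R -> R).
Hypothesis dD : is_derivation D.

Lemma derivationX x k : D (x ^+ k.+1) = k.+1%:R * (x ^+ k * D x).
Proof.
elim: k => [|k IH]; first by rewrite expr1 expr0 !mul1r.
by rewrite exprS (derivationM dD) IH -[k.+2]addn1 natrD exprS; ring.
Qed.

(** Ideals generated by elements that [D] kills are stable under [D], as [deriv_regular]
    requires. *)
Lemma ideal_span1_deriv f : D f = 0 -> forall h,
  (exists s, h = s * f) -> exists s, D h = s * f.
Proof. by move=> Df h [s ->]; exists (D s); rewrite (derivationM dD) Df mulr0 addr0. Qed.

Lemma ideal_span2_deriv f g : D f = 0 -> D g = 0 -> forall h,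
  (exists s t, h = s * f + t * g) -> exists s t, D h = s * f + t * g.
Proof.
move=> Df Dg h [s [t ->]]; exists (D s), (D t).
by rewrite (derivationD dD) !(derivationM dD) Df Dg !mulr0 !addr0.
Qed.

End Derivations.

Lemma is_ideal_span1 (R : comNzRingType) (f : R) :
  is_ideal (fun h => exists s, h = s * f).
Proof.
split=> [|x y [s ->] [t ->]|c x [s ->]].
- by exists 0; rewrite mul0r.
- by exists (s + t); rewrite mulrDl.
- by exists (c * s); rewrite mulrA.
Qed.

Lemma is_ideal_span2 (R : comNzRingType) (f g : R) :
  is_ideal (fun h => exists s t, h = s * f + t * g).
Proof.
split=> [|x y [s [t ->]] [s' [t' ->]]|c x [s [t ->]]].
- by exists 0, 0; rewrite !mul0r addr0.
- by exists (s + s'), (t + t'); ring.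
- by exists (c * s), (c * t); ring.
Qed.

Section DerivationRegular.
Variables (K : fieldType) (n : nat).
Hypothesis K_char0 : forall k, k.+1%:R != 0 :> K.
Notation S := {mpoly K[n]}.

(* Applying D repeatedly to f g = 0 mod I gives f^k D^k g = (-1)^k k! M^k g
   mod I, while f^(k+1) D^k g lies in I.  By the ascending chain condition some
   D^k g is a combination of the lower ones mod I, and multiplying that relation
   by f^k kills its right-hand side. *)
Lemma deriv_regular (D : S -> S) (I : S -> Prop) (f g M : S) :
  is_derivation D -> is_ideal I -> (forall h, I h -> I (D h)) ->
  D f = M -> I (f * g) -> exists m, I (M ^+ m * g).
Proof.
move=> dD idI DI Df Ifg.
pose G k := iter k D g; pose c k : K := (-1) ^+ k * (k`!)%:R.
have c0 k : c k != 0.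
  rewrite mulf_neq0 ?signr_eq0 //; have := fact_gt0 k.
  by case: (k`!) => // j _; apply: K_char0.
have fSG k : I (f ^+ k * G k - (c k)%:MP * (M ^+ k * g)) -> I (f ^+ k.+1 * G k).
  move=> h; have -> : f ^+ k.+1 * G k =
     f * (f ^+ k * G k - (c k)%:MP * (M ^+ k * g)) + (c k)%:MP * M ^+ k * (f * g).
    by rewrite exprS; ring.
  by apply: idealD => //; apply: idealM.
have main k : I (f ^+ k * G k - (c k)%:MP * (M ^+ k * g)).
  elim: k => [|k IH].
    by rewrite /c !expr0 fact0 mulr1n mulr1 mpolyC1 !mul1r subrr; apply: ideal0.
  have := DI _ (fSG _ IH); rewrite (derivationM dD) (derivationX dD) Df => h.
  have cE : (c k.+1)%:MP = - k.+1%:R * (c k)%:MP :> S.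
    rewrite /c factS natrM exprS -mpolyC_nat -mpolyCN -mpolyCM; congr (_%:MP).
    by ring.
  have -> : f ^+ k.+1 * G k.+1 - (c k.+1)%:MP * (M ^+ k.+1 * g) =
     (k.+1%:R * (f ^+ k * M) * G k + f ^+ k.+1 * D (G k))
     - k.+1%:R * M * (f ^+ k * G k - (c k)%:MP * (M ^+ k * g)).
    by rewrite cE /G /= [M ^+ k.+1]exprS; ring.
  by apply: idealB => //; apply: idealM.
(* [J k] is [I] enlarged by the first [k] iterates of [D] on [g]. *)
pose J k h := exists q : nat -> S, I (h - \sum_(j < k) q j * G j).
have idJ k : is_ideal (J k).
  split=> [|x y [q Iq] [r Ir]|d x [q Iq]].
  - exists (fun=> 0); rewrite big1 ?subr0 => [|j _]; first exact: ideal0.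
    by rewrite mul0r.
  - exists (fun j => q j + r j).
    under eq_bigr do rewrite mulrDl.
    by rewrite big_split opprD addrACA; apply: idealD.
  - exists (fun j => d * q j).
    under eq_bigr do rewrite -mulrA.
    by rewrite -mulr_sumr -mulrBr; apply: idealM.
have incJ k h : J k h -> J k.+1 h.
  move=> [q Iq]; exists (fun j => if (j < k)%N then q j else 0).
  rewrite big_ord_recr /= ltnn mul0r addr0 (eq_bigr (fun j : 'I_k => q j * G j)) //.
  by move=> j _; rewrite ltn_ord.
have [k kP] := mpoly_acc idJ incJ.
have [|q Iq] := kP (G k).
  exists (fun j => (j == k)%:R); rewrite big_ord_recr /= eqxx mul1r.
  rewrite big1 ?add0r ?subrr; first exact: ideal0.
  by move=> j _; rewrite (ltn_eqF (ltn_ord j)) mul0r.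
exists k.
have IfG : I (f ^+ k * G k).
  have -> : f ^+ k * G k = f ^+ k * (G k - \sum_(j < k) q j * G j) +
     \sum_(j < k) f ^+ (k - j.+1) * q j * (f ^+ j.+1 * G j).
    rewrite mulrBr -addrA -[LHS]addr0; congr (_ + _); apply/esym.
    rewrite addrC; apply/eqP; rewrite subr_eq0 mulr_sumr; apply/eqP.
    apply: eq_bigr => j _; have -> : f ^+ k = f ^+ (k - j.+1) * f ^+ j.+1.
      by rewrite -exprD subnK.
    by ring.
  apply: idealD => //; first exact: idealM.
  by apply: ideal_sum => // j _; apply: idealM => //; apply: fSG.
have Ic : I ((c k)%:MP * (M ^+ k * g)).
  by rewrite -(subKr (f ^+ k * G k) ((c k)%:MP * _)); apply: idealB.
have -> : M ^+ k * g = ((c k)^-1)%:MP * ((c k)%:MP * (M ^+ k * g)).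
  by rewrite [RHS]mulrA -mpolyCM mulVf // mpolyC1 mul1r.
exact: idealM.
Qed.

End DerivationRegular.

(** * Triples and their Koszul complexes *)

Local Notation i0 := (@Ordinal 3 0 isT).
Local Notation i1 := (@Ordinal 3 1 isT).
Local Notation i2 := (@Ordinal 3 2 isT).

Lemma ord3W (P : 'I_3 -> Prop) : P i0 -> P i1 -> P i2 -> forall i, P i.
Proof.
move=> h0 h1 h2 [[|[|[|k]]] lti] //.
- by have -> : Ordinal lti = i0 by apply: val_inj.
- by have -> : Ordinal lti = i1 by apply: val_inj.
- by have -> : Ordinal lti = i2 by apply: val_inj.
Qed.

Section Vectors.
Variable R : comNzRingType.
Implicit Types u v w : 'I_3 -> R.

Definition vec3 (a b c : R) : 'I_3 -> R :=
  fun i => match val i with 0%N => a | 1%N => b | _ => c end.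

Definition dot u v : R := u i0 * v i0 + u i1 * v i1 + u i2 * v i2.

Definition cross u v : 'I_3 -> R :=
  vec3 (u i1 * v i2 - u i2 * v i1) (u i2 * v i0 - u i0 * v i2)
       (u i0 * v i1 - u i1 * v i0).

(** The Koszul complex of [w] is R -> R^3 -> R^3 -> R with maps s to w s, u to w x u and p to w . p.
    [line_exact] is exactness at the first R^3, [dot_exact] at the second. *)
Definition line_exact w : Prop :=
  forall u, (forall i, cross w u i = 0) -> exists s, forall i, u i = w i * s.

Definition dot_exact w : Prop :=
  forall u, dot w u = 0 -> exists p, forall i, u i = cross w p i.

Lemma eq_cross u u' v v' : u =1 u' -> v =1 v' -> cross u v =1 cross u' v'.
Proof. by move=> hu hv; apply: ord3W; rewrite /cross /vec3 /= !hu !hv. Qed.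

Lemma eq_dot u u' v v' : u =1 u' -> v =1 v' -> dot u v = dot u' v'.
Proof. by move=> hu hv; rewrite /dot !hu !hv. Qed.

End Vectors.

Ltac vec_ring := rewrite /cross /dot /vec3 /=; ring.

Section KoszulLocal.
Variables (K : fieldType) (n : nat).
Hypothesis K_char0 : forall k, k.+1%:R != 0 :> K.
Notation S := {mpoly K[n]}.
Variables (F : 'I_3 -> S) (M : S) (E1 E2 : S -> S).
Hypotheses (dE1 : is_derivation E1) (dE2 : is_derivation E2).
Hypotheses (E10 : E1 (F i0) = 0) (E11 : E1 (F i1) = M).
Hypotheses (E20 : E2 (F i0) = 0) (E21 : E2 (F i1) = 0) (E22 : E2 (F i2) = M).
Hypothesis F0 : F i0 != 0.

(** [E1] makes F_1 regular modulo F_0 up to powers of [M]; as F_1 u_0 is a multiple of F_0, so is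
    M^m u_0. Cancelling F_0 gives the other two coordinates. *)
Lemma line_exact_loc u : (forall i, cross F u i = 0) ->
  exists m s, forall i, M ^+ m * u i = F i * s.
Proof.
move=> Fu.
have h1 : F i1 * u i0 = u i1 * F i0.
  by have /eqP := Fu i2; rewrite subr_eq0 => /eqP /= <-; rewrite mulrC.
have h2 : F i2 * u i0 = u i2 * F i0.
  by have /eqP := Fu i1; rewrite subr_eq0 => /eqP /= ->; rewrite mulrC.
have [|m [s e]] := deriv_regular K_char0 (g := u i0) dE1 (is_ideal_span1 (F i0))
  (ideal_span1_deriv dE1 E10) E11; first by exists (u i1).
exists m, s; apply: ord3W; first by rewrite e mulrC.
  apply: (mulfI F0); rewrite mulrCA [_ * u i1]mulrC -h1.
  by rewrite [LHS]mulrCA e; ring.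
apply: (mulfI F0); rewrite mulrCA [_ * u i2]mulrC -h2.
by rewrite [LHS]mulrCA e; ring.
Qed.

(** [E2] makes F_2 regular modulo (F_0, F_1) up to powers of [M], so M^m u_2 = s F_0 + t F_1.
    Removing the corresponding Koszul relations leaves a relation between F_0 and F_1 alone, with
    coefficients [w0] and [w1], which [E1] settles. *)
Lemma dot_exact_loc u : dot F u = 0 ->
  exists m p, forall i, M ^+ m * u i = cross F p i.
Proof.
rewrite /dot => Fu.
have [|m [s [t e]]] := deriv_regular K_char0 (g := u i2) dE2
    (is_ideal_span2 (F i0) (F i1)) (ideal_span2_deriv dE2 E20 E21) E22.
  exists (- u i0), (- u i1).
  by apply/eqP; rewrite -subr_eq0 -[X in _ == X]Fu; apply/eqP; ring.
pose w0 := M ^+ m * u i0 + F i2 * s; pose w1 := M ^+ m * u i1 + F i2 * t.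
have Fw : F i0 * w0 + F i1 * w1 = 0.
  have -> : F i0 * w0 + F i1 * w1 = M ^+ m * (F i0 * u i0 + F i1 * u i1 + F i2 * u i2)
     - F i2 * (M ^+ m * u i2 - (s * F i0 + t * F i1)) by rewrite /w0 /w1; ring.
  by rewrite Fu e subrr !mulr0 subrr.
have [|k [r e']] := deriv_regular K_char0 (g := w1) dE1 (is_ideal_span1 (F i0))
  (ideal_span1_deriv dE1 E10) E11.
  by exists (- w0); apply/eqP; rewrite -subr_eq0 -[X in _ == X]Fw; apply/eqP; ring.
have e0 : M ^+ k * w0 = - (F i1 * r).
  apply: (mulfI F0); apply/eqP; rewrite -subr_eq0; apply/eqP.
  have -> : F i0 * (M ^+ k * w0) - F i0 * - (F i1 * r) =
     M ^+ k * (F i0 * w0 + F i1 * w1) - F i1 * (M ^+ k * w1 - r * F i0) by ring.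
  by rewrite Fw e' subrr !mulr0 subrr.
exists (k + m)%N, (vec3 (- (M ^+ k * t)) (M ^+ k * s) (- r)).
rewrite exprD; apply: ord3W; rewrite /cross /vec3 /= -mulrA.
- have -> : M ^+ m * u i0 = w0 - F i2 * s by rewrite /w0; ring.
  by rewrite mulrBr e0; ring.
- have -> : M ^+ m * u i1 = w1 - F i2 * t by rewrite /w1; ring.
  by rewrite mulrBr e'; ring.
- by rewrite e; ring.
Qed.

End KoszulLocal.

Section Chases.
Variable R : idomainType.
Implicit Types u v w F a b : 'I_3 -> R.

(** If u x_l = w s_l for all l, cancelling w_j in w_j (x x s) = x x (u_j x) = 0 gives x x s = 0,
    hence s = x r and u = w r. *)
Lemma line_exact_sat (x w u : 'I_3 -> R) : line_exact x ->
  (exists l, x l != 0) -> (exists i, w i != 0) ->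
  (forall l, exists s, forall i, u i * x l = w i * s) ->
  exists s, forall i, u i = w i * s.
Proof.
move=> xE [l xl] [j wj] h.
pose s l := sval (constructive_indefinite_description _ (h l)).
have sP l' i : u i * x l' = w i * s l'.
  exact: (svalP (constructive_indefinite_description _ (h l')) i).
have [|r rP] := xE s.
  move=> k; apply: (mulfI wj); rewrite mulr0.
  have -> : w j * cross x s k = cross x (fun l => w j * s l) k.
    by move: k; apply: ord3W; vec_ring.
  rewrite (@eq_cross _ x x _ (fun l => u j * x l)) //.
  by move: k; apply: ord3W; vec_ring.
by exists r => i; apply: (mulIf xl); rewrite sP rP; ring.
Qed.

(** A chase in the double complex of [x] and [F]. With u x_l = F x p_l, the rows of [W] are killed
    by F x, so W_k = F v_k. Then x . v = 0, so v = x x q, and correcting p_l by F q_l makes it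
    proportional to x_l with common factor [r]. *)
Lemma dot_exact_sat (x F u : 'I_3 -> R) : line_exact x -> dot_exact x ->
  (exists l, x l != 0) -> (exists i, F i != 0) -> line_exact F ->
  (forall l, exists p, forall i, u i * x l = cross F p i) ->
  exists p, forall i, u i = cross F p i.
Proof.
move=> xL xD [l xl] [j Fj] FL h.
pose p l := sval (constructive_indefinite_description _ (h l)).
have pP l' i : u i * x l' = cross F (p l') i.
  exact: (svalP (constructive_indefinite_description _ (h l')) i).
pose W k i := cross x (fun l => p l i) k.
have WF k : exists s, forall i, W k i = F i * s.
  apply: FL => i.
  have -> : cross F (W k) i = cross x (fun l => cross F (p l) i) k.
    by move: k i; apply: ord3W; apply: ord3W; rewrite /W; vec_ring.
  rewrite (@eq_cross _ x x _ (fun l => u i * x l)) //.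
  by move: k; apply: ord3W; vec_ring.
pose v k := sval (constructive_indefinite_description _ (WF k)).
have vP k i : W k i = F i * v k.
  exact: (svalP (constructive_indefinite_description _ (WF k)) i).
have [|q qP] := xD v.
  apply: (mulfI Fj); rewrite mulr0.
  have -> : F j * dot x v = dot x (fun k => W k j) by rewrite /dot !vP; ring.
  by rewrite /W; vec_ring.
have rE i : exists r, forall l, p l i - F i * q l = x l * r.
  apply: (xL (fun l => p l i - F i * q l)) => k.
  have -> : cross x (fun l => p l i - F i * q l) k = W k i - F i * cross x q k.
    by move: k; apply: ord3W; rewrite /W; vec_ring.
  by rewrite vP qP subrr.
pose r i := sval (constructive_indefinite_description _ (rE i)).
have rP i l' : p l' i - F i * q l' = x l' * r i.
  exact: (svalP (constructive_indefinite_description _ (rE i)) l').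
exists r => i; apply: (mulIf xl); rewrite pP.
have pE k : p l k = x l * r k + F k * q l by rewrite -rP subrK.
rewrite (@eq_cross _ F F _ (fun k => x l * r k + F k * q l)) //.
by move: i; apply: ord3W; vec_ring.
Qed.

(** * A Hilbert-Burch argument for the minors of the rows [b] and [F] *)

Section HilbertBurch.
Variables a b F : 'I_3 -> R.
Hypothesis aE : forall i, a i = cross b F i.
Hypotheses (a0 : exists i, a i != 0) (F0 : exists i, F i != 0).
Hypotheses (FL : line_exact F) (FD : dot_exact F) (aL : line_exact a).

(** Since (b x F) x (s x F) = -F (s . a) = 0, exactness for [a] gives s x F = a p; then s - b p is
    killed by F x, hence a multiple of [F]. *)
Lemma syzygies s : dot s a = 0 ->
  exists p q, forall i, s i = b i * p + F i * q.
Proof.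
move=> sa.
have sa' : dot s (cross b F) = 0 by rewrite -sa; apply: eq_dot => // i.
have [|p pP] := aL (u := cross s F).
  move=> i; rewrite (@eq_cross _ a (cross b F) _ (cross s F)) //.
  have -> : cross (cross b F) (cross s F) i = - F i * dot s (cross b F).
    by move: i; apply: ord3W; vec_ring.
  by rewrite sa' mulr0.
have [|q qP] := FL (u := fun i => s i - b i * p).
  move=> i.
  have -> : cross F (fun i => s i - b i * p) i = cross b F i * p - cross s F i.
    by move: i; apply: ord3W; vec_ring.
  by rewrite pP aE subrr.
by exists p, q => i; rewrite -qP; ring.
Qed.

Lemma minors_sat g : (forall l, exists u, g * F l = dot u a) ->
  exists u, g = dot u a.
Proof.
move=> h; case: F0 => j Fj; case: a0 => j' aj.
pose u l := sval (constructive_indefinite_description _ (h l)).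
have uP l : g * F l = dot (u l) a.
  exact: (svalP (constructive_indefinite_description _ (h l))).
pose W k i := cross F (fun l => u l i) k.
(* The rows of F x u are syzygies of [a], because u_l . a = g F_l is proportional to F_l. *)
have WE k : exists pq : R * R, forall i, W k i = b i * pq.1 + F i * pq.2.
  have [|p [q pq]] := @syzygies (W k); last by exists (p, q).
  have -> : dot (W k) a = cross F (fun l => dot (u l) a) k.
    by move: k; apply: ord3W; rewrite /W; vec_ring.
  rewrite (@eq_cross _ F F _ (fun l => g * F l)) //.
  by move: k; apply: ord3W; vec_ring.
pose pq k := sval (constructive_indefinite_description _ (WE k)).
have pqP k i : W k i = b i * (pq k).1 + F i * (pq k).2.
  exact: (svalP (constructive_indefinite_description _ (WE k)) i).
pose rho k := (pq k).1; pose sigma k := (pq k).2.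
have rel i : b i * dot F rho + F i * dot F sigma = 0.
  have -> : b i * dot F rho + F i * dot F sigma = dot F (fun k => W k i).
    by rewrite /dot !pqP /rho /sigma; ring.
  by rewrite /W; vec_ring.
(* Crossing [rel] with [F] kills its second term and turns [b] into [a], which has a nonzero
   entry. *)
have rho0 : dot F rho = 0.
  apply: (mulfI aj); rewrite mulr0 aE.
  have -> : cross b F j' * dot F rho =
      cross (fun i => b i * dot F rho + F i * dot F sigma) F j'.
    by move: j' {aj}; apply: ord3W; rewrite /cross /vec3 /=; ring.
  rewrite (@eq_cross _ _ (fun=> 0) F F) //.
  by move: j' {aj}; apply: ord3W; vec_ring.
have sigma0 : dot F sigma = 0.
  by apply: (mulfI Fj); rewrite mulr0; have := rel j; rewrite rho0 mulr0 add0r.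
have [p pP] := FD rho0; have [q qP] := FD sigma0.
(* After these corrections u_l is F_l v; the corrections along [b] and [F] vanish when paired with a
   = b x F. *)
have vE i : exists v : R, forall l, u l i - b i * p l - F i * q l = F l * v.
  apply: (FL (u := fun l => u l i - b i * p l - F i * q l)) => k.
  have -> : cross F (fun l => u l i - b i * p l - F i * q l) k =
      W k i - b i * cross F p k - F i * cross F q k.
    by move: k; apply: ord3W; rewrite /W; vec_ring.
  by rewrite pqP -/(rho k) -/(sigma k) pP qP; ring.
pose v i := sval (constructive_indefinite_description _ (vE i)).
have vP i l : u l i - b i * p l - F i * q l = F l * v i.
  exact: (svalP (constructive_indefinite_description _ (vE i)) l).
exists v; apply: (mulIf Fj); rewrite uP.
have uE i : u j i = F j * v i + b i * p j + F i * q j by rewrite -vP; ring.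
rewrite (@eq_dot _ _ (fun i => F j * v i + b i * p j + F i * q j) a (cross b F)) //.
rewrite (@eq_dot _ v v a (cross b F)) //.
by vec_ring.
Qed.

End HilbertBurch.

End Chases.

(** * Calculus of polynomial maps *)

Section MpolyCalculus.
Variables (R : comNzRingType) (n : nat).
Notation S := {mpoly R[n]}.

Lemma mderiv_is_derivation i : is_derivation (fun p : S => p^`M(i)).
Proof. by split=> p q; rewrite ?mderivD ?mderivM. Qed.

Lemma is_derivation_comb (a b c : S) (i j k : 'I_n) :
  is_derivation (fun p : S => a * p^`M(i) + b * p^`M(j) + c * p^`M(k)).
Proof. by split=> p q; rewrite ?mderivD ?mderivM; ring. Qed.

Lemma mderivXU i j : ('X_j : S)^`M(i) = (i == j)%:R.
Proof.
rewrite mderivX mnm1E eq_sym; case: eqP => [->|_]; last by rewrite scale0r.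
by rewrite scale1r -[X in (X - _)%MM]addm0 addmC addmK mpolyX0.
Qed.

Lemma euler_homog (p : S) d : p \is d.-homog ->
  \sum_i 'X_i * p^`M(i) = d%:R * p.
Proof.
move=> /dhomogP hp; rewrite [in LHS](mpolyE p) [in RHS](mpolyE p).
have -> : \sum_i 'X_i * (\sum_(m <- msupp p) p@_m *: 'X_[m])^`M(i) =
    \sum_(m <- msupp p) \sum_i p@_m *: ('X_i * ('X_[m])^`M(i)).
  rewrite exchange_big /=; apply: eq_bigr => i _.
  rewrite raddf_sum mulr_sumr; apply: eq_bigr => m _ /=.
  by rewrite mderivZ scalerAr.
rewrite mulr_sumr !big_seq; apply: eq_bigr => m mp.
rewrite -scaler_sumr -scalerAr; congr (_ *: _).
have <- : mdeg m = d := hp m mp.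
rewrite mdegE natr_sum mulr_suml; apply: eq_bigr => i _.
rewrite mderivX -scalerAr -mpolyXD mulr_natl scaler_nat.
case: (posnP (m i)) => [->|mi]; first by rewrite !mulr0n.
by rewrite addmC submK // lep1mP -lt0n.
Qed.

End MpolyCalculus.

(** * Determinants of order three and vector identities *)

Lemma det3_rows (R : comNzRingType) (g : 'I_3 -> 'I_3 -> R) :
  \det (\matrix_(i, j) g i j) = dot (g i0) (cross (g i1) (g i2)).
Proof.
rewrite (expand_det_row _ ord0) !big_ord_recl big_ord0 /cofactor.
rewrite !(expand_det_row _ ord0) !big_ord_recl !big_ord0 /cofactor !det_mx11 !mxE /=.
rewrite /dot /cross /vec3 /=.
do ![rewrite (_ : lift _ _ = i0 :> 'I_3); last exact: val_inj
   | rewrite (_ : lift _ _ = i1 :> 'I_3); last exact: val_inj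
   | rewrite (_ : lift _ _ = i2 :> 'I_3); last exact: val_inj].
rewrite (_ : ord0 = i0); last exact: val_inj.
by ring.
Qed.

Lemma rank3_minor (K : fieldType) m (J : 'M[K]_(3, m)) :
  \rank J = 3 -> exists i j k,
  dot (fun l => J l i) (cross (fun l => J l j) (fun l => J l k)) != 0.
Proof.
move=> rJ; have fJ : row_full J^T by rewrite /row_full mxrank_tr rJ.
pose f := fullrankfun fJ.
exists (f i0), (f i1), (f i2).
have := fullrowsub_unit fJ; rewrite unitmxE unitfE.
have -> : rowsub (fullrankfun fJ) J^T = \matrix_(i, j) (fun a l => J l (f a)) i j.
  by apply/matrixP => a b; rewrite !mxE.
by rewrite det3_rows.
Qed.

Section VectorIdentities.
Variable R : comNzRingType.
Implicit Types u v w g h : 'I_3 -> R.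

Lemma eq_dotl u u' v : u =1 u' -> dot u v = dot u' v.
Proof. by move=> hu; apply: eq_dot. Qed.

Lemma eq_dotr u v v' : v =1 v' -> dot u v = dot u v'.
Proof. by move=> hv; apply: eq_dot. Qed.

Lemma dot_delta i w : dot (fun k => (k == i)%:R) w = w i.
Proof. by move: i; apply: ord3W; vec_ring. Qed.

Lemma dotDl u v w : dot (fun i => u i + v i) w = dot u w + dot v w.
Proof. by vec_ring. Qed.

Lemma dot_leibniz (p q : R) u v w :
  dot (fun i => u i * q + p * v i) w = dot u w * q + p * dot v w.
Proof. by vec_ring. Qed.

Lemma deriv_dot (D : R -> R) : is_derivation D -> forall u v,
  D (dot u v) = dot (fun i => D (u i)) v + dot u (fun i => D (v i)).
Proof.
by move=> dD u v; rewrite /dot !(derivationD dD) !(derivationM dD); ring.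
Qed.

Lemma subr_cancelr (x y h h' : R) : h = h' -> x + h - (y + h') = x - y.
Proof. by move=> ->; ring. Qed.

Lemma lin_comb0 (x y z f g h : R) : f = 0 -> g = 0 -> h = 0 ->
  x * f + y * g + z * h = 0.
Proof. by move=> -> -> ->; rewrite !mulr0 !addr0. Qed.

(** The adjugate times the matrix with columns [u], [v], [w], entrywise; it yields the derivations
    dual to the F_b. *)
Lemma adjugate3 u v w a b :
  cross v w a * u b + cross w u a * v b + cross u v a * w b =
  (a == b)%:R * dot u (cross v w).
Proof. by move: a b; apply: ord3W; apply: ord3W; vec_ring. Qed.

(** For [T] the Jacobian of a 1-form, this evaluates its exterior derivative on [g] and [h]. *)
Lemma curl_dot (T : 'I_3 -> 'I_3 -> R) g h :
  dot (fun i => dot (T i) g) h - dot (fun i => dot (T i) h) g =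
  dot (vec3 (T i2 i1 - T i1 i2) (T i0 i2 - T i2 i0) (T i1 i0 - T i0 i1)) (cross g h).
Proof. by vec_ring. Qed.

Lemma sum3E (f : 'I_3 -> R) : \sum_i f i = f i0 + f i1 + f i2.
Proof.
rewrite !big_ord_recr big_ord0 /= add0r.
by congr (f _ + f _ + f _); apply: val_inj.
Qed.

Lemma dotC u v : dot u v = dot v u.
Proof. by vec_ring. Qed.

Lemma crossZl (c : R) u v i : cross (fun i => c * u i) v i = c * cross u v i.
Proof. by move: i; apply: ord3W; vec_ring. Qed.

Lemma cross0_swap w u :
  (forall i, cross w u i = 0) -> forall l i, w l * u i = w i * u l.
Proof.
move=> h; have e0 := h i0; have e1 := h i1; have e2 := h i2.
move: e0 e1 e2 => /eqP + /eqP + /eqP; rewrite /cross /vec3 /= !subr_eq0.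
move=> /eqP e0 /eqP e1 /eqP e2.
by apply: ord3W; apply: ord3W.
Qed.

Lemma dot_scaled_delta u w a (m : R) :
  dot (fun=> 0) w + dot u (fun l => (a == l)%:R * m) = u a * m.
Proof. by move: a; apply: ord3W; vec_ring. Qed.

Lemma dot_scaled u v (m : R) : dot u (fun a => v a * m) = dot v u * m.
Proof. by vec_ring. Qed.

(** Cramer's rule, recovering each c_m times the determinant from the pairings of [c] with the cross
    products. *)
Lemma minor_expansion u v w c m :
  w m * dot c (cross u v) + u m * dot c (cross v w) + v m * dot c (cross w u) =
  c m * dot u (cross v w).
Proof. by move: m; apply: ord3W; vec_ring. Qed.

(** The two sides differ by (u x v)_l (a . b). For gradients [u], [v] this is A_l dA = A /\ eta_l
    pulled back. *)
Lemma contraction u v a b l : dot a b = 0 ->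
  a l * dot b (cross u v) =
  dot a u * cross v b l - dot a v * cross u b l.
Proof.
move=> ab; apply/eqP; rewrite -subr_eq0.
have -> : a l * dot b (cross u v) - (dot a u * cross v b l - dot a v * cross u b l) =
    cross u v l * dot a b by move: l; apply: ord3W; vec_ring.
by rewrite ab mulr0.
Qed.

Lemma contraction_comb u v a b c : dot a b = 0 ->
  dot c a * dot b (cross u v) =
  dot a u * dot c (cross v b) - dot a v * dot c (cross u b).
Proof.
move=> ab; have h l := contraction u v l ab.
have -> : dot c a * dot b (cross u v) = dot c (fun l => a l * dot b (cross u v)).
  by rewrite /dot; ring.
by rewrite (eq_dotr _ h) /dot; ring.
Qed.

(** For [T] the Jacobian of [w], the hypotheses are Euler's identity and the derivative of i_R w =
    0; the conclusion is i_R dw = (d + 1) w. *)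
Lemma euler_curl (X w : 'I_3 -> R) (T : 'I_3 -> 'I_3 -> R) (d : R) :
  (forall l, dot X (T l) = d * w l) ->
  (forall l, w l + dot X (fun i => T i l) = 0) ->
  forall l, cross (vec3 (T i2 i1 - T i1 i2) (T i0 i2 - T i2 i0) (T i1 i0 - T i0 i1)) X l
    = (d + 1) * w l.
Proof.
move=> hE hR l.
have -> : cross (vec3 (T i2 i1 - T i1 i2) (T i0 i2 - T i2 i0) (T i1 i0 - T i0 i1)) X l
    = dot X (T l) + w l - (w l + dot X (fun i => T i l)).
  by move: l; apply: ord3W; vec_ring.
by rewrite hE hR; ring.
Qed.

Lemma rmorph_dot (R' : comNzRingType) (f : {rmorphism R -> R'}) u v :
  f (dot u v) = dot (fun i => f (u i)) (fun i => f (v i)).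
Proof. by rewrite /dot !rmorphD !rmorphM. Qed.

Lemma rmorph_cross (R' : comNzRingType) (f : {rmorphism R -> R'}) u v i :
  f (cross u v i) = cross (fun i => f (u i)) (fun i => f (v i)) i.
Proof. by move: i; apply: ord3W; rewrite /cross /vec3 /= rmorphB !rmorphM. Qed.

End VectorIdentities.

(** * Products of ideals generated by pairs *)

Section Choices.
Variable R : comNzRingType.

(** Generators of the product of the ideals (p, p') over the pairs in [s]. *)
Fixpoint choices (s : seq (R * R)) : seq R :=
  if s is pq :: s' then
    [seq pq.1 * q | q <- choices s'] ++ [seq pq.2 * q | q <- choices s']
  else [:: 1].

(** The pairs are removed one at a time: if powers of p q and p' q lie in [T], [sat_pow] applied to
    the quotient of [T] by a power of [q] removes p and p'. *)
Lemma sat_choices (T : R -> Prop) (s : seq (R * R)) : is_ideal T ->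
  (forall pq, pq \in s -> forall f, T (f * pq.1) -> T (f * pq.2) -> T f) ->
  (forall q, q \in choices s -> exists k, T (q ^+ k)) -> T 1.
Proof.
move=> idT; elim: s => [|[p p'] s IH] sat cs.
  by have [k] := cs 1 (mem_head _ _); rewrite expr1n.
apply: IH => [pq pqs|q qs]; first by apply: sat; rewrite inE pqs orbT.
have [k Tk] : exists k, T ((p * q) ^+ k).
  by apply: cs; rewrite mem_cat (map_f (fun q => p * q)).
have [k' Tk'] : exists k, T ((p' * q) ^+ k).
  by apply: cs; rewrite mem_cat (map_f (fun q => p' * q)) ?orbT.
pose N := maxn k k'; exists N; rewrite -[q ^+ N]mul1r.
apply: (sat_pow (P := fun f => T (f * q ^+ N)) (z := fun b : bool => if b then p else p')).
- exact: ideal_scaled.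
- move=> f Tf; apply: (sat (p, p')); rewrite ?mem_head //= mulrAC.
    exact: (Tf true).
  exact: (Tf false).
- case; exists N; rewrite -exprMn.
    exact: (ideal_pow_le idT (leq_maxl k k')).
  exact: (ideal_pow_le idT (leq_maxr k k')).
Qed.

Lemma choices_vanish (R' : comNzRingType) (f : R -> R') (s : seq (R * R)) pq : pq \in s ->
  {morph f : x y / x * y} -> f pq.1 = 0 -> f pq.2 = 0 ->
  forall q, q \in choices s -> f q = 0.
Proof.
move=> + fM f1 f2; elim: s => // rr s IH; rewrite inE => /predU1P[<-|ps] q /=;
  rewrite mem_cat => /orP[] /mapP[q' q's ->]; rewrite fM ?f1 ?f2 ?mul0r //.
  by rewrite (IH ps q') ?mulr0.
by rewrite (IH ps q') ?mulr0.
Qed.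

End Choices.

(** [L] and [L'] cut out a line through 0 containing [p]. The direction [v] provides a derivation
    that kills [L] and sends [L'] to 1. *)
Lemma line_equations (K : fieldType) (p : 'I_3 -> K) :
  exists L L' v, [/\ dot L p = 0, dot L' p = 0, dot L v = 0, dot L' v = 1 &
                     exists l, L l != 0].
Proof.
have [p0|p0] := eqVneq (p i0) 0; last first.
  exists (vec3 (- p i1) (p i0) 0), (vec3 (- p i2) 0 (p i0)), (vec3 0 0 (p i0)^-1).
  by split; rewrite /dot /vec3 /=; [ring|ring|ring|field|exists i1].
have [p1|p1] := eqVneq (p i1) 0; last first.
  exists (vec3 1 0 0), (vec3 0 (- p i2) (p i1)), (vec3 0 0 (p i1)^-1).
  by split; rewrite /dot /vec3 /=; [rewrite p0; ring|ring|ring|field|exists i0; rewrite oner_eq0].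
(* The last coordinate axis also serves the case p = 0. *)
exists (vec3 1 0 0), (vec3 0 1 0), (vec3 0 1 0).
by split; rewrite /dot /vec3 /= ?p0 ?p1; [ring|ring|ring|ring|exists i0; rewrite oner_eq0].
Qed.

(** * Pulling polynomials and forms back along [F] *)

Section Composition.
Variables (n : nat) (F : 'I_3 -> Pol n.+1).

Lemma compFD p q : compF F (p + q) = compF F p + compF F q.
Proof. exact: comp_mpolyD. Qed.

Lemma compFB p q : compF F (p - q) = compF F p - compF F q.
Proof. exact: comp_mpolyB. Qed.

Lemma compFM p q : compF F (p * q) = compF F p * compF F q.
Proof. exact: rmorphM. Qed.

Lemma compFC c : compF F c%:MP = c%:MP.
Proof. exact: comp_mpolyC. Qed.

Lemma compFX i : compF F 'X_i = F i.
Proof. by rewrite /compF comp_mpolyXU -tnth_nth tnth_mktuple. Qed.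

Lemma compF_eval p x : (compF F p).@[x] = p.@[Fpt F x].
Proof.
by rewrite comp_mpoly_meval; apply: meval_eq => i; rewrite tnth_mktuple.
Qed.

Lemma compF_mderiv p j : (compF F p)^`M(j) =
  dot (fun i => compF F p^`M(i)) (fun i => (F i)^`M(j)).
Proof.
elim/mpoly_alg_ind: p => [c|i|p q hp hq|p q hp hq].
- rewrite compFC mderivC (@eq_dotl _ _ (fun=> 0)); last first.
    by move=> i; rewrite mderivC -mpolyC0 compFC.
  by rewrite /dot !mul0r !addr0.
- rewrite compFX (@eq_dotl _ _ (fun k => (k == i)%:R)); last first.
    by move=> k; rewrite mderivXU -mpolyC_nat compFC mpolyC_nat.
  by rewrite dot_delta.
- rewrite compFD mderivD; apply: etrans (congr2 +%R hp hq) _.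
  apply: etrans (esym (dotDl _ _ _)) _.
  by apply: eq_dotl => i; rewrite mderivD compFD.
- rewrite compFM mderivM.
  apply: etrans (congr2 (fun f g => f * compF F q + compF F p * g) hp hq) _.
  apply: etrans (esym (dot_leibniz _ _ _ _ _)) _.
  by apply: eq_dotl => i; rewrite mderivM compFD !compFM.
Qed.

Definition grad (j : 'I_n.+1) : 'I_3 -> Pol n.+1 := fun i => (F i)^`M(j).

Definition minor i j k : Pol n.+1 := dot (grad i) (cross (grad j) (grad k)).

(* The derivations given by the rows of the adjugate of the Jacobian block with
   columns i, j, k. *)
Definition adj_deriv i j k (a : 'I_3) (h : Pol n.+1) : Pol n.+1 :=
  cross (grad j) (grad k) a * h^`M(i) + cross (grad k) (grad i) a * h^`M(j) +
  cross (grad i) (grad j) a * h^`M(k).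

Lemma adj_deriv_is_derivation i j k a : is_derivation (adj_deriv i j k a).
Proof. exact: is_derivation_comb. Qed.

Lemma adj_derivE i j k a b :
  adj_deriv i j k a (F b) = (a == b)%:R * minor i j k.
Proof. exact: adjugate3. Qed.

Lemma adj_derivC i j k a c : adj_deriv i j k a c%:MP = 0.
Proof. by apply: lin_comb0; apply: mderivC. Qed.

Lemma minor_critical x : nonzero_pt x ->
  (forall i j k, (minor i j k).@[x] = 0) -> critical_pt F x.
Proof.
move=> x0 minx; split=> //; rewrite ltn_neqAle rank_leq_row andbT.
apply/eqP => /rank3_minor[i [j [k]]]; rewrite -[X in _ != X](minx i j k).
have gradE a : (fun l => jacobian F x l a) =1 (fun l => (grad a l).@[x]).
  by move=> l; rewrite mxE.
case/eqP; rewrite /minor (rmorph_dot (meval x)).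
apply: eq_dot => // l; rewrite (rmorph_cross (meval x)).
exact: eq_cross.
Qed.

(** The coefficients of dw on dx_1 /\ dx_2, dx_2 /\ dx_0, dx_0 /\ dx_1, so that wedge products and
    contractions become dot and cross products. *)
Definition curl (w : form1 3) : 'I_3 -> Pol 3 :=
  vec3 (dform w i1 i2) (dform w i2 i0) (dform w i0 i1).

Lemma pullbackE w j : pullback F w j = dot (fun i => compF F (w i)) (grad j).
Proof. by rewrite /pullback sum3E. Qed.

Lemma pullback_mderiv w k l : (pullback F w k)^`M(l) =
  dot (fun i => dot (fun a => compF F (w i)^`M(a)) (grad l)) (grad k) +
  dot (fun i => compF F (w i)) (fun i => (F i)^`M(k)^`M(l)).
Proof.
rewrite pullbackE; apply: etrans (deriv_dot (mderiv_is_derivation _ l) _ _) _.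
apply: (congr1 (fun z => z + _)); apply: eq_dotl => i; exact: compF_mderiv.
Qed.

(** Exterior derivative commutes with pullback: the second derivatives of [F] cancel by symmetry,
    and [curl_dot] rewrites the rest. *)
Lemma dform_pullback w i j : dform (pullback F w) i j =
  dot (fun l => compF F (curl w l)) (cross (grad i) (grad j)).
Proof.
apply: etrans (congr2 (fun f g => f - g) (pullback_mderiv w j i)
  (pullback_mderiv w i j)) _.
apply: etrans (subr_cancelr _ _ (eq_dotr _ (fun l => mderiv_comm j i (F l)))) _.
apply: etrans (curl_dot (fun l a => compF F (w l)^`M(a)) _ _) _.
by apply: eq_dotl; apply: ord3W; apply/esym; apply: compFB.
Qed.

End Composition.

(** * Conductors and exactness over projective space *)

Section Conductors.
Variable R : comNzRingType.
Implicit Types u v w : 'I_3 -> R.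

(** [line_cond] and [cross_cond] are the conductors of [u] into the images of the first two Koszul
    maps of [w]; exactness at [u] means that they contain 1. *)
Definition line_cond w u (s : R) : Prop := exists r, forall i, u i * s = w i * r.

Definition cross_cond w u (s : R) : Prop :=
  exists p, forall i, u i * s = cross w p i.

Definition dot_ideal w (s : R) : Prop := exists u, s = dot u w.

Lemma is_ideal_line_cond w u : is_ideal (line_cond w u).
Proof.
split=> [|x y [r hr] [r' hr']|c x [r hr]].
- by exists 0 => i; rewrite !mulr0.
- by exists (r + r') => i; rewrite !mulrDr hr hr'.
- by exists (c * r) => i; rewrite !(mulrCA _ c) hr.
Qed.

Lemma is_ideal_cross_cond w u : is_ideal (cross_cond w u).
Proof.
split=> [|x y [r hr] [r' hr']|c x [r hr]].
- by exists (fun=> 0); apply: ord3W; vec_ring.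
- by exists (fun i => r i + r' i) => i; rewrite mulrDr hr hr'; move: i;
    apply: ord3W; vec_ring.
- by exists (fun i => c * r i) => i; rewrite mulrCA hr; move: i;
    apply: ord3W; vec_ring.
Qed.

Lemma is_ideal_dot w : is_ideal (dot_ideal w).
Proof.
split=> [|x y [u ->] [v ->]|c x [u ->]].
- by exists (fun=> 0); vec_ring.
- by exists (fun i => u i + v i); vec_ring.
- by exists (fun i => c * u i); vec_ring.
Qed.

Lemma dot_ideal_gen w i : dot_ideal w (w i).
Proof. by exists (fun k => (k == i)%:R); rewrite dot_delta. Qed.

Lemma line_cond_gen w u : (forall i, cross w u i = 0) ->
  forall l, line_cond w u (w l).
Proof.
by move=> wu l; exists (u l) => i; rewrite mulrC (cross0_swap wu).
Qed.

(** Koszul homology is killed by the entries of [w]; crossing [u] with a basis vector is the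
    contracting homotopy. *)
Lemma cross_cond_gen w u : dot w u = 0 -> forall l, cross_cond w u (w l).
Proof.
move=> wu l; exists (cross u (fun k => (k == l)%:R)) => i.
have -> : cross w (cross u (fun k => (k == l)%:R)) i =
    u i * w l - (i == l)%:R * dot w u.
  by move: i l; apply: ord3W; apply: ord3W; vec_ring.
by rewrite wu mulr0 subr0.
Qed.

Lemma is_derivation_comb3 (E : 'I_3 -> R -> R) (v : 'I_3 -> R) :
  (forall a, is_derivation (E a)) -> is_derivation (fun h => dot v (fun a => E a h)).
Proof.
move=> dE; split=> x y /=; rewrite /dot ?(derivationD (dE _)) ?(derivationM (dE _)).
  by ring.
by ring.
Qed.

End Conductors.

Section ProjectiveNullstellensatz.
Variable n : nat.
Notation S := (Pol n.+1).

Definition coord3 (l : 'I_3) : S := 'X_(inord l).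

Lemma coord3_neq0 l : coord3 l != 0.
Proof.
apply/eqP => /(congr1 (fun p : S => p.@[fun=> 1])).
by rewrite mevalXU meval0 => /eqP; rewrite oner_eq0.
Qed.

Hypothesis n_ge2 : (2 <= n)%N.

Lemma mderiv_coord3 (l l' : 'I_3) : (coord3 l)^`M(inord l') = (l == l')%:R.
Proof.
have lt (k : 'I_3) : (k < n.+1)%N by apply: leq_trans (ltn_ord k) _.
rewrite mderivXU eq_sym; congr (_ %:R).
by rewrite -val_eqE /= !inordK.
Qed.

(** The partial derivatives serve as [E1] and [E2] with M = 1, so the local statements have no
    denominator. *)
Lemma coord3_exact : line_exact coord3 /\ dot_exact coord3.
Proof.
have dE (l : 'I_3) := mderiv_is_derivation Cf (inord l : 'I_n.+1).
split=> u hu.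
  have [m [s h]] := line_exact_loc Cf_char0 (dE i1) (mderiv_coord3 i0 i1)
    (mderiv_coord3 i1 i1) (coord3_neq0 i0) hu.
  by exists s => i; rewrite -h expr1n mul1r.
have [m [p h]] := dot_exact_loc Cf_char0 (dE i1) (dE i2) (mderiv_coord3 i0 i1)
  (mderiv_coord3 i1 i1) (mderiv_coord3 i0 i2) (mderiv_coord3 i1 i2)
  (mderiv_coord3 i2 i2) (coord3_neq0 i0) hu.
by exists p => i; rewrite -h expr1n mul1r.
Qed.

Definition no_nonzero_zero (P : S -> Prop) : Prop :=
  forall x, nonzero_pt x -> ~ (forall g, P g -> g.@[x] = 0).

Lemma coord_power (P : S -> Prop) : is_ideal P -> no_nonzero_zero P ->
  forall l, exists k, P ('X_l ^+ k).
Proof.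
move=> idP noz l; apply: (nullstellensatz_Cf idP) => x xP.
rewrite mevalXU; apply/eqP/negPn/negP => xl.
by apply: (noz x) => //; exists l.
Qed.

(** The conductor contains powers of the coordinates by the Nullstellensatz and is saturated with
    respect to three of them by [line_exact_sat], so it is the unit ideal. *)
Lemma line_exact_global (w u : 'I_3 -> S) : (exists i, w i != 0) ->
  no_nonzero_zero (line_cond w u) -> exists s, forall i, u i = w i * s.
Proof.
move=> w0 noz; have [xL _] := coord3_exact.
have x0 : exists l, coord3 l != 0 by exists i0; apply: coord3_neq0.
suff [s h] : line_cond w u 1 by exists s => i; rewrite -h mulr1.
apply: (@sat_pow _ _ _ coord3) => [|s h|l]; first exact: is_ideal_line_cond.
  apply: (line_exact_sat (u := fun i => u i * s) xL x0 w0) => l.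
  by have [r hr] := h l; exists r => i; rewrite -mulrA.
by apply: coord_power noz _; apply: is_ideal_line_cond.
Qed.

Lemma cross_exact_global (w u : 'I_3 -> S) : (exists i, w i != 0) ->
  line_exact w -> no_nonzero_zero (cross_cond w u) ->
  exists p, forall i, u i = cross w p i.
Proof.
move=> w0 wL noz; have [xL xD] := coord3_exact.
have x0 : exists l, coord3 l != 0 by exists i0; apply: coord3_neq0.
suff [s h] : cross_cond w u 1 by exists s => i; rewrite -h mulr1.
apply: (@sat_pow _ _ _ coord3) => [|s h|l]; first exact: is_ideal_cross_cond.
  apply: (dot_exact_sat (u := fun i => u i * s) xL xD x0 w0 wL) => l.
  by have [r hr] := h l; exists r => i; rewrite -mulrA.
by apply: coord_power noz _; apply: is_ideal_cross_cond.
Qed.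

End ProjectiveNullstellensatz.

(** * Linear forms and their derivatives along constant directions *)

Section LinearForms.
Variable n : nat.
Implicit Types (L v : 'I_3 -> Cf) (F : 'I_3 -> Pol n.+1).

Definition lin L : Pol 3 := dot (fun l => (L l)%:MP) (fun l => 'X_l).

Lemma lin_eval L x : (lin L).@[x] = dot L x.
Proof.
rewrite (rmorph_dot (meval x)); apply: eq_dot => l; first exact: mevalC.
exact: mevalXU.
Qed.

Lemma lin_homog L : lin L \is 1.-homog.
Proof.
have h l : (L l)%:MP * 'X_l \is [in Cf[3], 1.-homog].
  by rewrite mul_mpolyC dhomogZ // dhomogX /= mdeg1.
by rewrite /lin /dot !dhomogD.
Qed.

Lemma lin_neq0 L l : L l != 0 -> lin L != 0.
Proof.
apply: contraNneq => L0; have := lin_eval L (fun k => (k == l)%:R).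
rewrite L0 meval0 => /esym e; rewrite -e -(dot_delta l L).
by apply/eqP; rewrite /dot; ring.
Qed.

Lemma compF_lin F L : compF F (lin L) = dot (fun l => (L l)%:MP) F.
Proof.
apply: etrans (rmorph_dot (comp_mpoly _) _ _) _.
by apply: eq_dot => l; [exact: compFC | exact: compFX].
Qed.

Lemma adj_deriv_lin F i j k L v :
  dot (fun a => (v a)%:MP) (fun a => adj_deriv F i j k a (dot (fun l => (L l)%:MP) F)) =
  (dot L v)%:MP * minor F i j k.
Proof.
have E a : adj_deriv F i j k a (dot (fun l => (L l)%:MP) F) = (L a)%:MP * minor F i j k.
  apply: etrans (deriv_dot (adj_deriv_is_derivation F i j k a) _ _) _.
  apply: etrans (congr2 +%R (eq_dotl _ (fun l => adj_derivC F i j k a (L l)))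
    (eq_dotr _ (fun l => adj_derivE F i j k a l))) _.
  exact: (dot_scaled_delta (fun l => (L l)%:MP)).
apply: etrans (eq_dotr _ E) _.
apply: etrans (dot_scaled (fun a => (v a)%:MP) (fun a => (L a)%:MP) _) _.
congr (_ * _); apply/esym; exact: (rmorph_dot (@mpolyC n.+1 Cf)).
Qed.

End LinearForms.

(** * Generic pairs *)

(** Eliminations for [lin_pair_sat]: [l], [l'] are the pulled-back linear forms, [p], [p'] powers of
    the minor. *)
Lemma lin_pair_eq (R : comNzRingType) (t a f l l' p p' r r' : R) :
  t * (p * (f * l)) = a * r -> t * (p' * (f * l')) = a * r' ->
  a * (l' * (p' * r)) = a * (p * r' * l).
Proof.
move=> h h'.
have -> : a * (l' * (p' * r)) = l' * p' * (a * r) by ring.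
have -> : a * (p * r' * l) = p * l * (a * r') by ring.
by rewrite -h -h'; ring.
Qed.

Lemma lin_pair_eq2 (R : comNzRingType) (t a f l c p p' r s : R) :
  t * (p * (f * l)) = a * r -> c * (p' * r) = s * l ->
  t * (c * p' * p * f) * l = a * s * l.
Proof.
move=> h h'.
have -> : t * (c * p' * p * f) * l = c * p' * (t * (p * (f * l))) by ring.
rewrite h; have -> : c * p' * (a * r) = a * (c * (p' * r)) by ring.
by rewrite h'; ring.
Qed.

Lemma meval_pow_eq0 m (p : Pol m) k (x : 'I_m -> Cf) :
  (p ^+ k).@[x] = 0 -> p.@[x] = 0.
Proof. by rewrite rmorphXn /= => /eqP; rewrite expf_eq0 => /andP[_ /eqP]. Qed.

Lemma curl_eq0 (w : form1 3) (x : 'I_3 -> Cf) :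
  (forall l, (curl w l).@[x] = 0) -> forall i j, (dform w i j).@[x] = 0.
Proof.
move=> h.
have d0 i : (dform w i i).@[x] = 0 by rewrite /dform subrr meval0.
have dN i j : (dform w i j).@[x] = 0 -> (dform w j i).@[x] = 0.
  by move=> hij; rewrite /dform -opprB mevalN -/(dform w i j) hij oppr0.
have h01 : (dform w i0 i1).@[x] = 0 := h i2.
have h12 : (dform w i1 i2).@[x] = 0 := h i0.
have h20 : (dform w i2 i0).@[x] = 0 := h i1.
apply: ord3W; apply: ord3W;
  [exact: d0|exact: h01|exact: dN h20|exact: dN h01|exact: d0|exact: h12
  |exact: h20|exact: dN h12|exact: d0].
Qed.

Lemma cross_curl_homog (w : form1 3) d :
  (forall i, w i \is d.-homog) -> iR w = 0 ->
  forall l, cross (curl w) (fun i => 'X_i) l = (d%:R + 1) * w l.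
Proof.
move=> wh wR l.
apply: (@euler_curl _ (fun i => 'X_i) w (fun l k => (w l)^`M(k))) => [{}l|{}l].
  by apply: etrans (euler_homog (wh l)); rewrite sum3E.
have dotE : dot (fun i => 'X_i) w = 0 by rewrite -wR /iR sum3E.
have h : (dot (fun i => 'X_i) w)^`M(l) = 0 by rewrite dotE mderiv0.
apply: etrans _ h.
apply: etrans _ (esym (deriv_dot (mderiv_is_derivation _ l) (fun i => 'X_i) w)).
apply: (congr1 (fun z => z + _)); apply/esym.
rewrite (@eq_dotl _ _ (fun k => (k == l)%:R)); first exact: dot_delta.
by move=> k; rewrite mderivXU eq_sym.
Qed.

Section GenericPair.
Variables (n e nu : nat) (A : 'I_3 -> Pol 3) (F : 'I_3 -> Pol n.+1).
Hypotheses (folA : foliation_P2 e A) (F_homog : forall i, F i \is nu.-homog).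
Hypotheses (domF : dominant F) (genF : generic_pair F A).
Hypotheses (n_ge2 : (2 <= n)%N) (nu_gt0 : (0 < nu)%N).

Notation a := (fun i => compF F (A i)).
Notation b := (fun i => compF F (curl A i)).

Lemma compF_neq0 (G : Pol 3) d : G != 0 -> G \is d.-homog -> compF F G != 0.
Proof.
move=> G0 Gh; have [x [_ [_ Gx]]] := domF G0 Gh.
by apply: contraNneq Gx => cG; rewrite -compF_eval cG meval0.
Qed.

Lemma F_neq0 i : F i != 0.
Proof.
rewrite -(compFX F i); apply: (@compF_neq0 _ 1%N); last by rewrite dhomogX /= mdeg1.
apply/eqP => /(congr1 (fun p : Pol 3 => p.@[fun=> 1])).
by rewrite mevalXU meval0 => /eqP; rewrite oner_eq0.
Qed.

Lemma a_neq0 : exists i, a i != 0.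
Proof.
by case: folA => _ hA [i Ai] _ _; exists i; apply: compF_neq0 Ai (hA i).
Qed.

Lemma F_at_0 (x : 'I_n.+1 -> Cf) i : (forall l, x l = 0) -> (F i).@[x] = 0.
Proof.
move=> x0; have := congr1 (meval x) (euler_homog (F_homog i)).
rewrite rmorph_sum /= big1 => [|l _]; last by rewrite mevalM mevalXU x0 mul0r.
rewrite mevalM -mpolyC_nat mevalC => /esym/eqP; rewrite mulf_eq0 => /orP[|/eqP //].
by case: nu nu_gt0 => // k _; rewrite (negPf (Cf_char0 k)).
Qed.

(** Such a point would be critical, hence off the base locus, and its critical value would be
    singular. *)
Lemma minors_not_all_0 (x : 'I_n.+1 -> Cf) : nonzero_pt x ->
  (forall i, (a i).@[x] = 0) -> ~ (forall i j k, (minor F i j k).@[x] = 0).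
Proof.
move=> x0 ax /(minor_critical x0) crit; case: genF => _ _ g3 g4.
apply: (g3 x crit (g4 x crit)); split; first exact: g4.
by move=> i; rewrite -compF_eval.
Qed.

(** The conductor contains the F_l and a power of each minor, so a nonzero common zero would be a
    critical point on F = 0. The same reasoning proves [dot_exact_F]. *)
Lemma line_exact_F : line_exact F.
Proof.
move=> u hu; apply: line_exact_global => //; first by exists i0; apply: F_neq0.
move=> x x0 xP; case: genF => _ _ _ g4.
have Fx l : (F l).@[x] = 0 by apply: xP; apply: line_cond_gen.
have crit : critical_pt F x.
  apply: minor_critical => // i j k.
  have [m [s hs]] := line_exact_loc Cf_char0 (adj_deriv_is_derivation F i j k i1)
    (etrans (adj_derivE F i j k i1 i0) (mul0r _))
    (etrans (adj_derivE F i j k i1 i1) (mul1r _)) (F_neq0 i0) hu.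
  by apply: (@meval_pow_eq0 _ _ m); apply: xP; exists s => l; rewrite mulrC.
by have [l /eqP[]] := g4 x crit; apply: Fx.
Qed.

Lemma dot_exact_F : dot_exact F.
Proof.
move=> u hu; apply: cross_exact_global => //; first by exists i0; apply: F_neq0.
  exact: line_exact_F.
move=> x x0 xP; case: genF => _ _ _ g4.
have Fx l : (F l).@[x] = 0 by apply: xP; apply: cross_cond_gen.
have crit : critical_pt F x.
  apply: minor_critical => // i j k.
  have [m [s hs]] := dot_exact_loc Cf_char0 (adj_deriv_is_derivation F i j k i1)
    (adj_deriv_is_derivation F i j k i2)
    (etrans (adj_derivE F i j k i1 i0) (mul0r _))
    (etrans (adj_derivE F i j k i1 i1) (mul1r _))
    (etrans (adj_derivE F i j k i2 i0) (mul0r _))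
    (etrans (adj_derivE F i j k i2 i1) (mul0r _))
    (etrans (adj_derivE F i j k i2 i2) (mul1r _)) (F_neq0 i0) hu.
  by apply: (@meval_pow_eq0 _ _ m); apply: xP; exists s => l; rewrite mulrC.
by have [l /eqP[]] := g4 x crit; apply: Fx.
Qed.

(** Comparing the two relations shows L'(F) r divisible by L(F) up to powers of [M]. The derivation
    along [v] kills L(F) and sends L'(F) to [M], so L(F) divides [r] itself up to such powers and
    can be cancelled. *)
Lemma lin_pair_sat t i j k (M := minor F i j k) L L' v :
  dot L v = 0 -> dot L' v = 1 -> (exists l, L l != 0) ->
  forall f : Pol 3, (exists m, line_cond a t (M ^+ m * compF F (f * lin L))) ->
  (exists m, line_cond a t (M ^+ m * compF F (f * lin L'))) ->
  exists m, line_cond a t (M ^+ m * compF F f).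
Proof.
move=> Lv L'v [l Ll] f [m [r hr]] [m' [r' hr']]; case: a_neq0 => z az.
have LF0 : compF F (lin L) != 0 := compF_neq0 (lin_neq0 Ll) (lin_homog L).
have eqL : compF F (lin L') * (M ^+ m' * r) = M ^+ m * r' * compF F (lin L).
  apply: (mulfI az); move: (hr z) (hr' z); rewrite !compFM.
  exact: (@lin_pair_eq _ _ (a z) (compF F f)).
pose D h := dot (fun c => (v c)%:MP) (fun c => adj_deriv F i j k c h).
have dD : is_derivation D.
  by apply: is_derivation_comb3 => c; apply: adj_deriv_is_derivation.
have DL : D (compF F (lin L)) = 0.
  by rewrite compF_lin /D adj_deriv_lin Lv mpolyC0 mul0r.
have DL' : D (compF F (lin L')) = M.
  by rewrite compF_lin /D adj_deriv_lin L'v mpolyC1 mul1r.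
have [|c [s hs]] := deriv_regular Cf_char0 (g := M ^+ m' * r) dD
  (is_ideal_span1 (compF F (lin L))) (ideal_span1_deriv dD DL) DL'.
  by eexists; exact: eqL.
exists (c + m' + m)%N, s => y; apply: (mulIf LF0).
move: (hr y) hs; rewrite compFM !exprD; exact: lin_pair_eq2.
Qed.

Lemma minor_line_cond t i j k : (forall l, cross a t l = 0) ->
  exists m, line_cond a t (minor F i j k ^+ m).
Proof.
move=> at0; set M := minor F i j k.
(* [T] lives in the three target variables and contains the A_l, so its zeros lie on finitely many
   lines through 0. Products of equations of these lines have powers in [T], and [lin_pair_sat]
   removes the factors. *)
pose T f := exists m, line_cond a t (M ^+ m * compF F f).
have idP := is_ideal_line_cond a t.
have idT : is_ideal T.
  split=> [|f g [m hm] [m' hm']|c f [m hm]].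
  - by exists 0%N; rewrite /compF comp_mpoly0 mulr0; apply: ideal0.
  - exists (m + m')%N; rewrite compFD; exact: (ideal_powD idP hm hm').
  - by exists m; rewrite compFM mulrCA; exact: (idealM idP _ hm).
have TA l : T (A l) by exists 0%N; rewrite expr0 mul1r; apply: (line_cond_gen at0).
suff [m] : T 1 by rewrite /compF comp_mpoly1 mulr1 => ?; exists m.
case: folA => _ _ _ _ [_ [k' [p pP]]].
(* [None] supplies a line for the origin, which [in_sing] excludes. *)
pose p' (o : option 'I_k') := if o is Some c then p c else fun=> 0.
have eqs o : exists LL : ('I_3 -> Cf) * ('I_3 -> Cf),
    [/\ dot LL.1 (p' o) = 0, dot LL.2 (p' o) = 0 &
      exists v, [/\ dot LL.1 v = 0, dot LL.2 v = 1 & exists l, LL.1 l != 0]].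
  have [L [L' [v [h1 h2 h3 h4 h5]]]] := line_equations (p' o).
  by exists (L, L'); split=> //; exists v.
pose LL o := sval (constructive_indefinite_description _ (eqs o)).
have LLP o : [/\ dot (LL o).1 (p' o) = 0, dot (LL o).2 (p' o) = 0 &
    exists v, [/\ dot (LL o).1 v = 0, dot (LL o).2 v = 1 & exists l, (LL o).1 l != 0]].
  exact: (svalP (constructive_indefinite_description _ (eqs o))).
pose pair o := (lin (LL o).1, lin (LL o).2).
apply: (@sat_choices _ T [seq pair o | o <- enum {: option 'I_k'}] idT).
  move=> _ /mapP[o _ ->] f; have [_ _ [v [h1 h2 h3]]] := LLP o.
  exact: lin_pair_sat h1 h2 h3 f.
move=> q qs; apply: (nullstellensatz_Cf idT) => x xT.
have [o [c xE]] : exists o c, forall l, x l = p' o l * c.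
  case: (classic (nonzero_pt x)) => [x0|x0]; last first.
    exists None, 0 => l; rewrite mulr0; apply/eqP/negPn/negP => xl.
    by apply: x0; exists l.
  have [|jj [c xc]] := pP x; first by split=> // l; apply: xT.
  by exists (Some jj), c => l; rewrite xc mulrC.
have [h1 h2 _] := LLP o.
apply: (@choices_vanish _ _ (meval x) _ (pair o) _ _ _ _ _ qs).
- by rewrite map_f // mem_enum.
- by move=> f g; rewrite mevalM.
- by rewrite lin_eval (eq_dotr _ xE) dot_scaled dotC h1 mul0r.
- by rewrite lin_eval (eq_dotr _ xE) dot_scaled dotC h2 mul0r.
Qed.

Lemma line_exact_a : line_exact a.
Proof.
move=> t at0; apply: (line_exact_global n_ge2 a_neq0) => x x0 xP.
apply: (minors_not_all_0 x0) => [i|i j k].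
  by apply: xP; apply: (line_cond_gen at0).
have [m hm] := minor_line_cond i j k at0.
exact: meval_pow_eq0 (xP _ hm).
Qed.

(** Euler's identity e A = curl A x y pulled back, with e inverted. *)
Lemma a_cross : exists b', forall l, a l = cross b' F l.
Proof.
case: folA => e2 hA _ RA _.
have e1 : (e.-1)%:R + 1 = (e%:R)%:MP :> Pol 3.
  by rewrite mpolyC_nat -{2}(prednK (ltnW e2)) natr1.
have e0 : e%:R != 0 :> Cf by rewrite -(prednK (ltnW e2)) Cf_char0.
have h l : (e%:R)%:MP * a l = cross b F l.
  have := congr1 (compF F) (cross_curl_homog hA RA l).
  rewrite e1 compFM compFC => <-.
  apply: etrans (rmorph_cross (comp_mpoly _) _ _ l) _.
  by apply: eq_cross => k //; apply: compFX.
exists (fun l => (e%:R^-1)%:MP * b l) => l; rewrite crossZl -h [RHS]mulrA.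
by rewrite -mpolyCM mulVf // mpolyC1 mul1r.
Qed.

Lemma ideal_a_sat g : (forall l, dot_ideal a (g * F l)) -> dot_ideal a g.
Proof.
have [b' hb] := a_cross; have F0 : exists i, F i != 0 by exists i0; apply: F_neq0.
exact: (minors_sat hb a_neq0 F0 line_exact_F dot_exact_F line_exact_a).
Qed.

Lemma J_sub_a g : J_ideal (pullback F A) g -> dot_ideal a g.
Proof.
move=> [c ->]; have idA := is_ideal_dot a.
apply: (ideal_sum idA) => j _; apply: (idealM idA).
by exists (grad F j); rewrite pullbackE dotC.
Qed.

Lemma K_sub_a h : K_ideal (pullback F A) h -> dot_ideal a h.
Proof.
move=> hK; have idA := is_ideal_dot a.
have Kdw i j : dot_ideal a (h * dot b (cross (grad F i) (grad F j))).
  rewrite -dform_pullback; apply: J_sub_a; apply: hK.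
  exists (fun ij => (ij == (i, j))%:R); rewrite (bigD1 (i, j)) //= eqxx mul1r.
  by rewrite big1 ?addr0 // => ij /negPf ->; rewrite mul0r.
pose P s := dot_ideal a (s * h).
have idP : is_ideal P := ideal_scaled idA h.
have Pa l : P (a l) by exact: (ideal_mulr idA h (dot_ideal_gen a l)).
have Pb m i j k : P (b m * minor F i j k).
  have /(congr1 P) <- := minor_expansion (grad F i) (grad F j) (grad F k) b m.
  exact: (comb3_ideal idA _ _ _ (Kdw i j) (Kdw j k) (Kdw k i)).
have PF l : exists k, P (F l ^+ k).
  (* At a zero of [P] with F_l nonzero, [a] vanishes, so the image is singular; the Kupka condition
     makes some b_m nonzero there, forcing all minors to vanish. *)
  apply: (nullstellensatz_Cf idP) => x xP; apply/eqP/negPn/negP => Fxl.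
  have x0 : nonzero_pt x.
    apply: NNPP => nx; case/eqP: Fxl; apply: F_at_0 => z.
    by apply/eqP/negPn/negP => xz; apply: nx; exists z.
  have ax i : (a i).@[x] = 0 by apply: xP.
  have singF : in_sing A (Fpt F x).
    by split=> [|i]; [exists l | rewrite -compF_eval].
  case: genF => _ kup _ _; have [i [j dAij]] := kup _ singF.
  have [m bm] : exists m, (b m).@[x] != 0.
    apply: NNPP => nb; case/eqP: dAij; apply: curl_eq0 => m.
    rewrite -compF_eval; apply/eqP/negPn/negP => bm.
    by apply: nb; exists m.
  apply: (minors_not_all_0 x0 ax) => i' j' k'.
  have /eqP := xP _ (Pb m i' j' k'); rewrite mevalM mulf_eq0 (negPf bm) /=.
  by move/eqP.
have P1 : P 1.
  apply: (sat_pow idP _ PF) => s hs; apply: ideal_a_sat => l.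
  by rewrite mulrAC; apply: hs.
by move: P1; rewrite /P mul1r.
Qed.

Lemma a_sub_I h : dot_ideal a h -> I_ideal (pullback F A) h.
Proof.
move=> [c ->]; case: folA => _ _ _ _ [intA _].
have AB : dot A (curl A) = 0.
  apply: etrans (intA i0 i1 i2); rewrite /dot /curl /vec3 /= /wedge12.
  congr (_ + _); rewrite -mulrN; congr (_ + _ * _).
  by rewrite /dform opprB.
have ab : dot a b = 0.
  apply: etrans (esym (rmorph_dot (comp_mpoly _) A (curl A))) _.
  by rewrite AB; apply: comp_mpoly0.
(* [contraction] combined with the coefficients [c] gives this eta. *)
exists (fun j => dot c (cross (grad F j) b)) => i j.
rewrite dform_pullback /wedge11 !pullbackE.
exact: contraction_comb.
Qed.

Lemma I_sub_K h : I_ideal (pullback F A) h -> K_ideal (pullback F A) h.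
Proof.
set w := pullback F A; move=> [eta hI] c [d ->].
have idJ : is_ideal (J_ideal w).
  split=> [|x y [u ->] [v ->]|z x [u ->]].
  - by exists (fun=> 0); rewrite big1 // => i _; rewrite mul0r.
  - by exists (fun i => u i + v i); rewrite -big_split; apply: eq_bigr => i _;
      rewrite /= mulrDl.
  - by exists (fun i => z * u i); rewrite mulr_sumr; apply: eq_bigr => i _;
      rewrite mulrA.
have Jw i : J_ideal w (w i).
  exists (fun k => (k == i)%:R); rewrite (bigD1 i) //= eqxx mul1r.
  by rewrite big1 ?addr0 // => k /negPf ->; rewrite mul0r.
rewrite mulr_sumr; apply: (ideal_sum idJ) => -[i j] _ /=.
rewrite mulrCA hI; apply: (idealM idJ); apply: (idealB idJ).
  exact: (ideal_mulr idJ).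
exact: (ideal_mulr idJ).
Qed.

End GenericPair.

(** * Dimension count for dominant maps *)

Section DominantDimension.
Variables (n nu : nat) (F : 'I_3 -> Pol n.+1).
Hypotheses (F_homog : forall i, F i \is nu.-homog) (domF : dominant F).
Variable k : nat.

(** Bounding both indices by [k] keeps the truncated subtraction exact. *)
Definition box_mnm (ij : 'I_k.+1 * 'I_k.+1) : 'X_{1..3} :=
  (U_(i0) *+ ij.1 + U_(i1) *+ ij.2 + U_(i2) *+ (k.*2 - ij.1 - ij.2))%MM.

Lemma box_mnm_inj : injective box_mnm.
Proof.
move=> [i j] [i' j'] h.
have := congr1 (fun m : 'X_{1..3} => m i0) h; have := congr1 (fun m : 'X_{1..3} => m i1) h.
rewrite /box_mnm !mnmDE !mulmnE !mnm1E /= !(muln0, muln1, mul0n, mul1n, addn0, add0n) => hj hi.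
by congr (_, _); apply: val_inj.
Qed.

Lemma mdeg_box_mnm ij : mdeg (box_mnm ij) = k.*2.
Proof.
rewrite /box_mnm !mdegD !mdegMn !mdeg1.
by have := ltn_ord ij.1; have := ltn_ord ij.2; lia.
Qed.

Lemma compF_monomial_homog m : compF F 'X_[m] \is (nu * mdeg m).-homog.
Proof.
rewrite /compF comp_mpolyX mdegE big_distrr /=.
elim/big_rec2: _ => [|i d p _ hp]; first exact: dhomog1.
by rewrite tnth_mktuple; apply: dhomogM => //; apply: dhomogMn.
Qed.

(* The monomials y^(i, j, 2k-i-j) with i, j <= k already give (k+1)^2 forms of
   degree 2k, whose pullbacks have degree 2 k nu. *)
Lemma dominant_dim (N : nat) (s : 'I_N -> 'X_{1..n.+1}) :
  (forall m, mdeg m = (nu * k.*2)%N -> exists c, m = s c) -> (k.+1 * k.+1 <= N)%N.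
Proof.
move=> hs; rewrite leqNgt; apply/negP => ltN.
pose T := ('I_k.+1 * 'I_k.+1)%type.
have cT : #|{: T}| = (k.+1 * k.+1)%N by rewrite card_prod !card_ord.
(* A vector in the left kernel of [B] is a form [G] with zero pullback, contradicting dominance. *)
pose B := \matrix_(c < #|{: T}|, d < N) (compF F 'X_[box_mnm (enum_val c)])@_(s d).
have /rowV0Pn[v /sub_kermxP vB v0] : kermx B != 0.
  rewrite -mxrank_eq0 mxrank_ker subn_eq0 -ltnNge.
  by apply: leq_ltn_trans (rank_leq_col _) _; rewrite cT.
pose G : Pol 3 := \sum_c v 0 c *: 'X_[box_mnm (enum_val c)].
have Ghom : G \is (k.*2).-homog.
  by apply: rpred_sum => c _; apply: rpredZ; rewrite dhomogX /= mdeg_box_mnm.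
have G0 : G != 0.
  apply: contraNneq v0 => G0; apply/eqP/rowP => c; rewrite mxE.
  have := congr1 (mcoeff (box_mnm (enum_val c))) G0.
  rewrite mcoeff0 raddf_sum /= (bigD1 c) //= mcoeffZ mcoeffX eqxx mulr1.
  rewrite big1 ?addr0 // => d dc; rewrite mcoeffZ mcoeffX.
  by rewrite (inj_eq box_mnm_inj) (inj_eq enum_val_inj) (negPf dc) mulr0.
have GF : compF F G = \sum_c v 0 c *: compF F 'X_[box_mnm (enum_val c)].
  by rewrite /compF raddf_sum /=; apply: eq_bigr => c _; rewrite comp_mpolyZ.
have GF0 : compF F G = 0.
  have Fh : compF F G \is (nu * k.*2).-homog.
    rewrite GF; apply: rpred_sum => c _; apply: rpredZ.
    by have := compF_monomial_homog (box_mnm (enum_val c)); rewrite mdeg_box_mnm.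
  apply/mpolyP => m; rewrite mcoeff0.
  case: (eqVneq (mdeg m) (nu * k.*2)%N) => [/hs[d ->]|nm]; last first.
    exact: dhomog_nemf_coeff Fh nm.
  have := congr1 (fun C : 'rV_N => C 0 d) vB; rewrite !mxE => vB0.
  rewrite -[RHS]vB0 GF raddf_sum /=; apply: eq_bigr => c _.
  by rewrite mcoeffZ mxE.
by have [x [_ [_ /eqP[]]]] := domF G0 Ghom; rewrite -compF_eval GF0 meval0.
Qed.

End DominantDimension.

Lemma dominant_dim_source n nu (F : 'I_3 -> Pol n.+1) :
  (forall i, F i \is nu.-homog) -> dominant F -> (2 <= n)%N.
Proof.
move=> Fh domF; rewrite leqNgt; apply/negP => n1.
(* With this [k], (k + 1)^2 = 4 nu^2 + 8 nu + 4 exceeds d + 1 = 4 nu^2 + 2 nu + 1, which bounds the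
   number of monomials of degree [d] in at most two variables. *)
pose k := nu.*2.+1; pose d := (nu * k.*2)%N.
have := @dominant_dim n nu F Fh domF k d.+1
  (fun c => [multinom if (i : nat) == 0%N then (c : nat) else (d - c)%N | i < n.+1]).
suff h : forall m : 'X_{1..n.+1}, mdeg m = d -> exists c : 'I_d.+1,
    m = [multinom if (i : nat) == 0%N then (c : nat) else (d - c)%N | i < n.+1].
  by move/(_ h); rewrite /d /k; nia.
move=> m md; have le : (m ord0 <= d)%N by rewrite -md mdegE (bigD1 ord0) //= leq_addr.
exists (Ordinal (le : m ord0 < d.+1)%N); apply/mnmP => i; rewrite mnmE /=.
case: (eqVneq i ord0) => [-> //|i0']; rewrite ifN; last first.
  by apply: contra i0' => /eqP i0E; apply/eqP/val_inj.
rewrite -md mdegE (bigD1 ord0) //= addKn (bigD1 i) //= big1 ?addn0 // => j.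
case/andP=> j0 ji; exfalso.
have hi := ltn_ord i; have hj := ltn_ord j.
have : (i : nat) != (j : nat) by rewrite val_eqE eq_sym.
have : (i : nat) != 0%N by rewrite (val_eqE i ord0).
have : (j : nat) != 0%N by rewrite (val_eqE j ord0).
lia.
Qed.

Lemma dominant_degree n nu (F : 'I_3 -> Pol n.+1) :
  (forall i, F i \is nu.-homog) -> dominant F -> (0 < nu)%N.
Proof.
move=> Fh domF; case: posnP => // nu0.
(* In degree zero there is a single monomial, while k = 1 would require four. *)
have := @dominant_dim n nu F Fh domF 1 1 (fun=> 0%MM).
by apply=> m; rewrite nu0 mul0n => /eqP; rewrite mdeg_eq0 => /eqP ->; exists ord0.
Qed.

Theorem theorem5p1 (n e nu : nat) (A : 'I_3 -> Pol 3) (F : 'I_3 -> Pol n.+1) :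
  foliation_P2 e A ->
  (forall i, F i \is nu.-homog) ->
  dominant F ->
  generic_pair F A ->
  forall h : Pol n.+1,
    (I_ideal (pullback F A) h <-> K_ideal (pullback F A) h) /\
    (K_ideal (pullback F A) h <-> in_ideal (fun i : 'I_3 => compF F (A i)) h).
Proof.
move=> folA Fh domF genF h.
have n2 := dominant_dim_source Fh domF; have nu0 := dominant_degree Fh domF.
have Ka := @K_sub_a n e nu A F folA Fh domF genF n2 nu0 h.
have aI := @a_sub_I n e A F folA h; have IK := @I_sub_K n A F h.
have aE : in_ideal (fun i : 'I_3 => compF F (A i)) h <->
    dot_ideal (fun i => compF F (A i)) h.
  by split=> [[c ->]|[c ->]]; exists c; rewrite sum3E.
by split; split; [exact: IK|move/Ka/aI|move/Ka/aE|move/aE/aI/IK].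
Qed.
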